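(* Let $w\in\mathfrak S_n$, let $\gamma$ be translation by $-\rho=(0,-1,\dots,1-n)$, and consider the normal ordering \[ :\nu_{\gamma^{-1}w\gamma}:\;=\sum_{x\in\widehat{\mathfrak S}_n}T_xg_x,\qquad g_x\in\mathcal K[\widetilde{\mathcal Y}]. \] Then $:\nu_{\gamma^{-1}w\gamma}:$ has leading term $T_{\gamma^{-1}w\gamma}$, and the leading coefficient $g_{\gamma^{-1}w\gamma}$ has neither a zero nor a pole at the point $t^{-2\rho}$ (i.e. $Y_i=t^{2-2i}$, $1\le i\le n$). Moreover, no lower order coefficient $g_x$ has a pole at $t^{-2\rho}$.
   Context: $\mathcal K$ a field, $t\in\mathcal K^\times$ not a root of unity, $n=N$, and $\mathbb H$ the $\mathrm{GL}_n$ DAHA with quadratic parameter $t$ and loop parameter $q=t^{-2}$: generators $T_0,\dots,T_{n-1},\pi^{\pm1},Y_1^{\pm1},\dots,Y_n^{\pm1}$, relations $(T_i-t)(T_i+t^{-1})=0$; $T_iT_jT_i=T_jT_iT_j$ ($j\equiv i\pm1\bmod n$), $T_iT_j=T_jT_i$ otherwise; $\pi T_i\pi^{-1}=T_{i+1}$, $\pi T_{n-1}\pi^{-1}=T_0$; $T_iY_iT_i=Y_{i+1}$ ($1\le i<n$), $T_0Y_nT_0=q^{-1}Y_1$; $T_iY_j=Y_jT_i$ ($j\not\equiv i,i+1$); $\pi Y_i\pi^{-1}=Y_{i+1}$, $\pi Y_n\pi^{-1}=q^{-1}Y_1$. Extend indices: $T_{j+mn}=T_j$, $Y_{i+mn}=q^{-m}Y_i$.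 Set $f_{ij}=tY_i-t^{-1}Y_j$; $\mathcal K[\widetilde{\mathcal Y}]$ and $\widetilde{\mathbb H}$ are the (Ore) localizations of $\mathcal K[Y^{\pm1}]$ and $\mathbb H$ at all $f_{ij}$ with $i\not\equiv j\bmod n$. Intertwiners: $\varphi_i=T_iY_i-Y_iT_i$, $\nu_i=\varphi_if_{i,i+1}^{-1}\in\widetilde{\mathbb H}$, $\nu_\pi=\pi$, and $\nu_w=\nu_{i_1}\cdots\nu_{i_m}$ for a reduced expression $w=s_{i_1}\cdots s_{i_m}$ (possibly including $\pi$) of $w\in\widehat{\mathfrak S}_n$ (independent of the reduced expression). $\widehat{\mathfrak S}_n$ is the extended affine symmetric group (bijections $w$ of $\mathbb Z$ with $w(i+n)=w(i)+n$), generated by $s_0,\dots,s_{n-1},\pi$; translation by $\beta\in\mathbb Z^n$ is $i\mapsto i+n\beta_{i\bmod n}$. Let $\mathcal H(\mathcal X)$ be the subalgebra generated by $T_1,\dots,T_{n-1},\pi^{\pm1}$, with basis $\{T_w:w\in\widehat{\mathfrak S}_n\}$ ($T_w$ the product along a reduced expression, $T_\pi=\pi$). Every $h\in\widetilde{\mathbb H}$ has a unique normal ordering $:h:=\sum_wT_wg_w$ with $g_w\in\mathcal K[\widetilde{\mathcal Y}]$, finitely many nonzero. It has leading term $T_w$ with leading coefficient $g_w$ if $g_w\ne0$ and every $x\ne w$ with $g_x\ne0$ has $\ell(x)<\ell(w)$. *)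

(* Defs.v *)
From HB Require Import structures.
From mathcomp Require Import all_boot all_order all_algebra.
From mathcomp Require Import fingroup perm fraction.
From mathcomp Require Import mpoly.
Set Implicit Arguments. Unset Strict Implicit. Unset Printing Implicit Defensive.
Import Order.TTheory GRing.Theory Num.Theory.
Local Open Scope ring_scope.
Notation "x %:F" := (@FracField.tofrac _ x) : ring_scope.

(* The extended affine symmetric group, elements represented by their *)
(* windows [w(1); ...; w(n)] (w : Z -> Z, w(i+n) = w(i)+n).           *)
Section Group.
Variable n : nat.

Definition wext (w : seq int) (i : int) : int :=
  nth 0 w `|((i - 1) %% n%:Z)%Z|%N + ((i - 1) %/ n%:Z)%Z * n%:Z.

Definition window (f : int -> int) : seq int :=
  [seq f (k%:Z + 1) | k <- iota 0 n].

Definition wmul (x y : seq int) : seq int := window (fun i => wext x (wext y i)).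
Definition wid : seq int := window id.
Definition sfun (i : int) (j : int) : int :=
  if ((j - i) %% n%:Z)%Z == 0 then j + 1
  else if ((j - i - 1) %% n%:Z)%Z == 0 then j - 1 else j.
Definition wsi (i : 'I_n) : seq int := window (sfun i%:Z).
Definition wpi : seq int := window (fun i => i + 1).
Definition wpiinv : seq int := window (fun i => i - 1).
Definition wperm (w : 'S_n) : seq int := [seq (w k)%:Z + 1 | k <- enum 'I_n].
(* translation by beta (beta_k = beta (k-1), k = 1..n) : i |-> i + n beta_(i mod n) *)
Definition wtrans (beta : nat -> int) : seq int :=
  [seq k%:Z + 1 + n%:Z * beta k | k <- iota 0 n].
Definition wgamma : seq int := wtrans (fun k => - k%:Z).
Definition wgammainv : seq int := wtrans (fun k => k%:Z).

Definition letter := ('I_n + bool)%type.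
Definition lval (l : letter) : seq int :=
  match l with inl i => wsi i | inr true => wpi | inr false => wpiinv end.
Definition wval (wd : seq letter) : seq int := foldr (fun l acc => wmul (lval l) acc) wid wd.
Definition scount (wd : seq letter) : nat := count (fun l : letter => if l is inl _ then true else false) wd.
Definition is_elt (x : seq int) : Prop := exists wd, wval wd = x.
Definition reduced (wd : seq letter) : Prop :=
  forall wd', wval wd' = wval wd -> (scount wd <= scount wd')%N.
Definition shorter (x y : seq int) : Prop :=
  exists wx, wval wx = x /\ forall wy, wval wy = y -> (scount wx < scount wy)%N.
End Group.

(* Coefficients: the Laurent ring K[Y^{+-1}] localized at the f_ij,   *)
(* realised inside the fraction field of K[Y_1..Y_n].                 *)
(* Variable 'X_k (k : 'I_n) stands for Y_(k+1).                        *)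
Section Coeffs.
Variables (K : fieldType) (n : nat) (t : K).
Local Notation P := {mpoly K[n]}.
Local Notation F := {fraction P}.

Definition qq : K := t ^- 2.

Definition Yext (i : int) : P :=
  (qq ^ (- ((i - 1) %/ n%:Z)%Z)) *:
    oapp (fun k : 'I_n => 'X_k) 0 (insub `|((i - 1) %% n%:Z)%Z|%N).

Definition fY (i j : int) : P := t *: Yext i - t^-1 *: Yext j.

Definition denom_factor (p : P) : Prop :=
  (exists k : 'I_n, p = 'X_k) \/
  (exists i j : int, ((i %% n%:Z)%Z != (j %% n%:Z)%Z) /\ p = fY i j).

Definition adm_denom (d : P) : Prop :=
  exists fs : seq P, (forall p, p \in fs -> denom_factor p) /\ d = \prod_(p <- fs) p.

Definition inKY (g : F) : Prop :=
  exists a d : P, adm_denom d /\ g = a%:F / d%:F.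

Definition ptrho : 'I_n -> K := fun k => t ^- (2 * k)%N.

Definition no_pole (g : F) : Prop :=
  exists a b : P, b.@[ptrho] != 0 /\ g = a%:F / b%:F.
Definition no_zero_no_pole (g : F) : Prop :=
  exists a b : P, a.@[ptrho] != 0 /\ b.@[ptrho] != 0 /\ g = a%:F / b%:F.
End Coeffs.

(* Models of the localized DAHA ~H: a K-algebra A with elements       *)
(* T_0..T_(n-1), pi^{+-1}, an evaluation ev : K[Y] -> A (Y_i = ev 'X), *)
(* and iota : K[~Y] -> A (given on the subset K[~Y] of the fraction   *)
(* field) satisfying the defining relations.                           *)
Section Model.
Variables (K : fieldType) (n : nat) (t : K) (A : algType K).
Variables (T : 'I_n -> A) (pi piinv : A) (ev : {rmorphism {mpoly K[n]} -> A})
          (iota : {fraction {mpoly K[n]}} -> A).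

Definition Tz (i : int) : A := oapp T 0 (insub `|(i %% n%:Z)%Z|%N).
Definition YA (i : int) : A := ev (Yext n t i).

Definition is_unit_A (a : A) : Prop := exists b, b * a = 1 /\ a * b = 1.

Definition daha_relations : Prop :=
      (forall c : K, ev (c%:MP) = c%:A) /\
      (forall k : 'I_n, is_unit_A (ev 'X_k)) /\
      (pi * piinv = 1 /\ piinv * pi = 1) /\
      (forall i : 'I_n, (T i - t%:A) * (T i + t^-1%:A) = 0) /\
      (forall i j : int, ((i %% n%:Z)%Z != (j %% n%:Z)%Z) ->
         if ((j - i - 1) %% n%:Z == 0)%Z || ((j - i + 1) %% n%:Z == 0)%Z
         then ((2 < n)%N -> Tz i * Tz j * Tz i = Tz j * Tz i * Tz j)
         else Tz i * Tz j = Tz j * Tz i) /\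
      (forall i : int, pi * Tz i * piinv = Tz (i + 1)) /\
      ((forall i : int, 1 <= i < n%:Z -> Tz i * YA i * Tz i = YA (i + 1)) /\
       Tz 0 * YA n%:Z * Tz 0 = (qq t)^-1 *: YA 1) /\
      (forall i j : int, 1 <= j <= n%:Z -> ((j - i) %% n%:Z != 0)%Z ->
          ((j - i - 1) %% n%:Z != 0)%Z -> Tz i * YA j = YA j * Tz i) /\
      ((forall i : int, 1 <= i < n%:Z -> pi * YA i * piinv = YA (i + 1)) /\
       pi * YA n%:Z * piinv = (qq t)^-1 *: YA 1).

Definition iota_spec : Prop :=
  (forall a d, adm_denom t d -> iota (a%:F / d%:F) * ev d = ev a) /\
  (forall i j : int, ((i %% n%:Z)%Z != (j %% n%:Z)%Z) -> is_unit_A (ev (fY n t i j))).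

Definition Tletter (l : letter n) : A :=
  match l with inl i => T i | inr true => pi | inr false => piinv end.
Definition Tword (wd : seq (letter n)) : A := \prod_(l <- wd) Tletter l.

Definition nuletter (l : letter n) : A :=
  match l with
  | inl i => (T i * YA i%:Z - YA i%:Z * T i) * iota (1 / (fY n t i%:Z (i%:Z + 1))%:F)
  | inr true => pi
  | inr false => piinv
  end.
Definition nuword (wd : seq (letter n)) : A := \prod_(l <- wd) nuletter l.

Definition Tw_spec (Tw : seq int -> A) : Prop :=
  forall wd, reduced wd -> Tw (wval wd) = Tword wd.

Definition normal_ordering (Tw : seq int -> A) (h : A)
  (s : seq (seq int)) (g : seq int -> {fraction {mpoly K[n]}}) : Prop :=
  [/\ uniq s, (forall x, x \in s -> is_elt n x /\ inKY t (g x)  ) &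
      h = \sum_(x <- s) Tw x * iota (g x)].

Definition nocoef (s : seq (seq int)) (g : seq int -> {fraction {mpoly K[n]}}) (x : seq int) :=
  if x \in s then g x else 0.

Definition unique_normal_ordering (Tw : seq int -> A) : Prop :=
  forall h s g s' g', normal_ordering Tw h s g -> normal_ordering Tw h s' g' ->
    forall x, nocoef s g x = nocoef s' g' x.
End Model.

(* Main.v *)
Require Import Defs.
From HB Require Import structures.
From mathcomp Require Import all_boot all_order all_algebra.
From mathcomp Require Import fingroup perm fraction.
From mathcomp Require Import mpoly.
From mathcomp Require Import zify ring.
Import Order.TTheory GRing.Theory Num.Theory.
Local Open Scope ring_scope.
Set Implicit Arguments. Unset Strict Implicit. Unset Printing Implicit Defensive.

(** Both halves of the statement rest on the fact that the intertwiner nu_wd of a word wd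
    depends only on the group element: two reduced words for x give intertwiners with the
    same leading term, so their difference has strictly lower terms and still satisfies
    Y h = h (x^-1 Y); comparing leading terms forces it to vanish, since the Y_j are pairwise
    distinct. Together with nu_i^2 = 1 this covers all words.

    Leading coefficient: it is the product of (Y_i - Y_j) / f_ij over the inversions of
    gamma^-1 w gamma. For each inversion a < b of w the factors with Y_i - Y_j = 0 and with
    f_ij = 0 at the point occur once each, and they are proportional; nothing else vanishes.

    Regularity: gamma^-1 S_n gamma fixes the point, so the h having a regular normal ordering
    (a left H-module) are stable under right multiplication by nu_v as soon as nu_v itself is
    regular. This reduces the claim to adjacent transpositions, for which gamma^-1 s_a gamma
    is the reflection u exchanging a and a + n + 1. Writing u = x s_i x^-1 with
    x = s_a s_(a+1) ... s_(a+n-2), one has nu_u = phi_x phi_i phi_(x^-1) / prod f, and exactly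
    one factor f_(a+1,a) of the denominator vanishes at the point. Expanding only the middle
    letter, phi_i = T_i (Y_i - Y_(i+1)) + (t - t^-1) Y_(i+1), gives two terms: the first acquires
    the right factor Y_a - Y_(a+n+1), proportional to f_(a+1,a); the second is
    phi_x phi_(x^-1) times a polynomial, and phi_a^2 = f_(a,a+1) f_(a+1,a) supplies
    the same factor. *)

(** * Periodic bijections of the integers and words in the s_i and pi *)

Section AffinePermutations.
Variable n : nat.
Hypothesis n_gt1 : (1 < n)%N.

Definition periodic (f : int -> int) := forall i, f (i + n%:Z) = f i + n%:Z.

Lemma periodicM f i (m : int) : periodic f -> f (i + m * n%:Z) = f i + m * n%:Z.
Proof.
move=> pf; have pos k : f (i + k%:Z * n%:Z) = f i + k%:Z * n%:Z.
  elim: k => [|k IHk]; first by rewrite mul0r !addr0.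
  by rewrite -addn1 PoszD mulrDl mul1r addrA pf IHk addrA.
have neg k j : f (j - k%:Z * n%:Z) = f j - k%:Z * n%:Z.
  elim: k j => [|k IHk] j; first by rewrite mul0r !subr0.
  have := pf (j - k%:Z * n%:Z - n%:Z); rewrite subrK IHk => e.
  have -> : j - k.+1%:Z * n%:Z = j - k%:Z * n%:Z - n%:Z by rewrite -addn1 PoszD; ring.
  by rewrite -[LHS](addrK n%:Z) -e -addn1 PoszD; ring.
by case: m => k; [exact: pos | rewrite NegzE mulNr neg].
Qed.

(** Coordinates on the integers: the residue [r] is zero-based, as is the index of the variable
    ['X_r] that stands for Y_(r+1). *)
Definition ix (r : 'I_n) (m : int) : int := r%:Z + 1 + m * n%:Z.

Lemma n_neq0 : n%:Z != 0. Proof. by rewrite -lt0n ltnW. Qed.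

Lemma ixP i : exists r m, i = ix r m.
Proof.
have lt : (`|((i - 1) %% n%:Z)%Z| < n)%N.
  by rewrite -ltz_nat gez0_abs ?modz_ge0 ?n_neq0 // ltz_pmod // ltz_nat ltnW.
exists (Ordinal lt), ((i - 1) %/ n%:Z)%Z; rewrite /ix /=.
rewrite gez0_abs ?modz_ge0 ?n_neq0 //.
by rewrite -[LHS](subrK 1) [X in X + 1](divz_eq (i - 1) n%:Z); ring.
Qed.

Lemma divz_small_add (a : nat) (k : int) :
  (a < n)%N -> ((a%:Z + k * n%:Z) %/ n%:Z)%Z = k.
Proof. by move=> la; rewrite addrC divzMDl ?n_neq0 // divz_small ?addr0 ?lez_nat ?ltz_nat ?la //. Qed.

Lemma modz_small_add (a : nat) (k : int) :
  (a < n)%N -> ((a%:Z + k * n%:Z) %% n%:Z)%Z = a.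
Proof. by move=> la; rewrite addrC modzMDl modz_small ?lez_nat ?ltz_nat ?la. Qed.

Lemma ix_div r m : ((ix r m - 1) %/ n%:Z)%Z = m.
Proof. by rewrite /ix addrAC addrK divz_small_add. Qed.

Lemma ix_mod r m : ((ix r m - 1) %% n%:Z)%Z = r.
Proof. by rewrite /ix addrAC addrK modz_small_add. Qed.

Lemma ix_inj r m r' m' : ix r m = ix r' m' -> r = r' /\ m = m'.
Proof.
move=> e; split; last by rewrite -(ix_div r m) e ix_div.
by apply/val_inj/eqP; rewrite /= -eqz_nat -(ix_mod r m) e ix_mod.
Qed.

(** Division with remainder based at [i] itself, so that s_i acts on the remainder alone, exchanging
    0 and 1. *)
Lemma repP i j : exists a k, (a < n)%N /\ j = i + a%:Z + k * n%:Z.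
Proof.
have [r [m e]] := ixP (j - i + 1); exists r, m; split=> //.
by rewrite -[LHS](subrK i) -[j - i](addrK 1) e /ix; ring.
Qed.

Definition flip01 (a : nat) : nat := if a == 0 then 1 else if a == 1 then 0 else a.

Lemma sfun_rep i (a : nat) k : (a < n)%N ->
  sfun n i (i + a%:Z + k * n%:Z) = i + (flip01 a)%:Z + k * n%:Z.
Proof.
move=> la; rewrite /sfun.
have -> : i + a%:Z + k * n%:Z - i = a%:Z + k * n%:Z by ring.
rewrite modz_small_add // /flip01 eqz_nat; case: eqP => [->|na]; first by ring.
have -> : a%:Z + k * n%:Z - 1 = a.-1%:Z + k * n%:Z by lia.
rewrite modz_small_add ?eqz_nat; last by lia.
have -> : (a.-1 == 0) = (a == 1) by lia.
by case: eqP => [->|n1] //; ring.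
Qed.

Lemma flip01K a : flip01 (flip01 a) = a.
Proof. by case: a => [|[|a]]. Qed.

Lemma flip01_lt a : (a < n)%N -> (flip01 a < n)%N.
Proof. by case: a => [|[|a]] //= _; apply: ltnW. Qed.

Lemma sfunK i : involutive (sfun n i).
Proof.
move=> j; have [a [k [la ->]]] := repP i j.
by rewrite sfun_rep // sfun_rep ?flip01_lt // flip01K.
Qed.

Lemma sfun_periodic i : periodic (sfun n i).
Proof.
move=> j; have [a [k [la ->]]] := repP i j.
rewrite sfun_rep // -addrA (_ : k * _ + _ = (k + 1) * n%:Z); last by ring.
by rewrite sfun_rep //; ring.
Qed.

Lemma sfun_shift i m : sfun n (i + m * n%:Z) =1 sfun n i.
Proof.
move=> j; have [a [k [la ->]]] := repP i j.
rewrite sfun_rep // (_ : i + _ + _ = i + m * n%:Z + a%:Z + (k - m) * n%:Z); last by ring.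
by rewrite sfun_rep //; ring.
Qed.

Lemma sfunl i : sfun n i i = i + 1.
Proof. by have := @sfun_rep i 0 0 (ltnW n_gt1); rewrite mul0r !addr0. Qed.

Lemma sfunr i : sfun n i (i + 1) = i.
Proof. by rewrite -(sfunl i) sfunK. Qed.

Definition lfun (l : letter n) : int -> int :=
  match l with inl i => sfun n i%:Z | inr true => fun j => j + 1 | inr false => fun j => j - 1 end.
Definition linv (l : letter n) : letter n :=
  match l with inl i => inl i | inr b => inr (~~ b) end.
Definition wfun (wd : seq (letter n)) : int -> int :=
  foldr (fun l f => lfun l \o f) id wd.
Definition winv (wd : seq (letter n)) := rev (map linv wd).

Lemma lfun_periodic l : periodic (lfun l).
Proof. by case: l => [i|[]] j; rewrite /= ?sfun_periodic // addrAC. Qed.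

Lemma linvK : involutive linv.
Proof. by case=> [i|[]]. Qed.

Lemma lfunK l : cancel (lfun l) (lfun (linv l)).
Proof. by case: l => [i|[]] j; rewrite /= ?sfunK ?addrK ?subrK. Qed.

Lemma wfun_periodic wd : periodic (wfun wd).
Proof. by elim: wd => //= l wd IH i /=; rewrite IH lfun_periodic. Qed.

Lemma wfun_cat w1 w2 : wfun (w1 ++ w2) =1 wfun w1 \o wfun w2.
Proof. by elim: w1 => //= l w1 IH i /=; rewrite IH. Qed.

Lemma winv_cons l wd : winv (l :: wd) = winv wd ++ [:: linv l].
Proof. by rewrite /winv /= rev_cons -cats1. Qed.

Lemma winv_cat w1 w2 : winv (w1 ++ w2) = winv w2 ++ winv w1.
Proof. by rewrite /winv map_cat rev_cat. Qed.

Lemma winvK : involutive winv.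
Proof. by move=> wd; rewrite /winv map_rev revK mapK //; exact: linvK. Qed.

Lemma wfunK wd : cancel (wfun wd) (wfun (winv wd)).
Proof.
by elim: wd => //= l wd IH i; rewrite winv_cons wfun_cat /= lfunK IH.
Qed.

Lemma wfunVK wd : cancel (wfun (winv wd)) (wfun wd).
Proof. by rewrite -{2}(winvK wd); exact: wfunK. Qed.

Lemma winv_ext w1 w2 : wfun w1 =1 wfun w2 -> wfun (winv w1) =1 wfun (winv w2).
Proof. by move=> e i; rewrite -{1}(wfunVK w2 i) -e wfunK. Qed.

Lemma scount_cons (l : letter n) wd :
  scount (l :: wd) = ((if l is inl _ then 1 else 0) + scount wd)%N.
Proof. by case: l. Qed.

Lemma wext_window f : periodic f -> wext n (window n f) =1 f.
Proof.
move=> pf i; have [r [m ->]] := ixP i; rewrite /wext ix_div ix_mod /window absz_nat.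
by rewrite (nth_map 0%N) ?size_iota // nth_iota // add0n /ix (periodicM _ _ pf).
Qed.

Lemma wval_cons (l : letter n) wd : wval (l :: wd) = wmul n (lval l) (wval wd).
Proof. by []. Qed.

Lemma window_ext f g : f =1 g -> window n f = window n g.
Proof. by move=> e; apply: eq_map => k; rewrite e. Qed.

Lemma lvalE (l : letter n) : lval l = window n (lfun l).
Proof. by case: l => [i|[]]. Qed.

Lemma wvalE (wd : seq (letter n)) : wval wd = window n (wfun wd).
Proof.
elim: wd => // l wd IH; rewrite wval_cons IH lvalE.
apply: window_ext => i.
by rewrite !wext_window //; first [exact: lfun_periodic | exact: wfun_periodic].
Qed.

Lemma wvalP (w1 w2 : seq (letter n)) : wval w1 = wval w2 <-> wfun w1 =1 wfun w2.
Proof.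
rewrite !wvalE; split; last exact: window_ext.
by move=> e i; rewrite -wext_window ?e ?wext_window //; exact: wfun_periodic.
Qed.

Lemma wext_wval (wd : seq (letter n)) : wext n (wval wd) =1 wfun wd.
Proof. by move=> i; rewrite wvalE wext_window //; exact: wfun_periodic. Qed.

(** * Products over the inversions of an affine permutation *)

Section InversionProduct.
Variables (V : Type) (idx : V) (op : Monoid.com_law idx) (rho : int -> int -> V).

(* Shi's parametrisation: for residues a < b the inversions of f in the classes of *)
(* (a, b) are the (a, b + j n), 0 <= j < - m, resp. the (b - j n, a), 0 < j <= m,  *)
(* where m = floor ((f b - f a) / n).                                              *)
Definition invterm (a b m : int) : V :=
  match m with
  | Posz k => \big[op/idx]_(1 <= j < k.+1) rho (b - j%:Z * n%:Z) a
  | Negz k => \big[op/idx]_(0 <= j < k.+1) rho a (b + j%:Z * n%:Z)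
  end.

Definition pairslope (f : int -> int) (a b : 'I_n) : int :=
  ((f (b%:Z + 1) - f (a%:Z + 1)) %/ n%:Z)%Z.

Definition invprod (f : int -> int) : V :=
  \big[op/idx]_(p : 'I_n * 'I_n | (p.1 < p.2)%N)
     invterm (p.1%:Z + 1) (p.2%:Z + 1) (pairslope f p.1 p.2).

Lemma invprod_ext f g : f =1 g -> invprod f = invprod g.
Proof. by move=> e; apply: eq_bigr => p _; rewrite /pairslope !e. Qed.

Lemma invprod_shift f k : invprod (fun i => f i + k) = invprod f.
Proof.
apply: eq_bigr => p _; congr (invterm _ _ _); rewrite /pairslope.
by congr (_ %/ _)%Z; ring.
Qed.

(** The last term is the borrow of the subtraction. Applying s_i alters offsets from [i] and not
    quotients, so a slope can change only through it. *)
Lemma divz_diff i (a b : nat) k l : (a < n)%N -> (b < n)%N ->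
  ((i + b%:Z + l * n%:Z - (i + a%:Z + k * n%:Z)) %/ n%:Z)%Z = l - k - (b < a)%N%:Z.
Proof.
move=> la lb; case: ltnP => lab.
  have -> : i + b%:Z + l * n%:Z - (i + a%:Z + k * n%:Z) =
            (n + b - a)%N%:Z + (l - k - 1) * n%:Z.
    have e : (n + b - a)%N%:Z = n%:Z + b%:Z - a%:Z by lia.
    by rewrite e; ring.
  by rewrite divz_small_add //; lia.
have -> : i + b%:Z + l * n%:Z - (i + a%:Z + k * n%:Z) =
          (b - a)%N%:Z + (l - k) * n%:Z by rewrite -subzn //; ring.
by rewrite divz_small_add ?subr0 //; lia.
Qed.

Lemma flip01_ltE a b : (a < 2)%N && (b < 2)%N = false ->
  (flip01 b < flip01 a)%N = (b < a)%N.
Proof. by case: a b => [|[|a]] [|[|b]]. Qed.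

Hypothesis rho_shift : forall i j, rho (i + n%:Z) (j + n%:Z) = rho i j.

Lemma rho_shiftM i j m : rho (i + m * n%:Z) (j + m * n%:Z) = rho i j.
Proof.
have pos k u v : rho (u + k%:Z * n%:Z) (v + k%:Z * n%:Z) = rho u v.
  elim: k => [|k IHk]; first by rewrite mul0r !addr0.
  by rewrite -addn1 PoszD mulrDl mul1r !addrA rho_shift.
case: m => k; first exact: pos.
by rewrite NegzE mulNr -(pos k.+1) !subrK.
Qed.

Variables (f g : int -> int) (pf : periodic f).
Hypotheses (fK : cancel f g) (gK : cancel g f).

Lemma inv_periodic : periodic g.
Proof. by move=> i; rewrite -[RHS]fK pf gK. Qed.

(** The values of [f] have offset 0 or 1 from [i] only on the classes of [A] and [B]; for any other
    pair of residues the exchange of 0 and 1 keeps the order of the offsets. *)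
Lemma pairslope_far i (A B : 'I_n) kA kB (a b : 'I_n) :
    g i = ix A kA -> g (i + 1) = ix B kB -> a != b ->
    (a, b) != (A, B) -> (a, b) != (B, A) ->
  pairslope (sfun n i \o f) a b = pairslope f a b.
Proof.
move=> eA eB nab n1 n2; rewrite /pairslope /=.
have [x [k [lx ex]]] := repP i (f (a%:Z + 1)).
have [y [l [ly ey]]] := repP i (f (b%:Z + 1)).
have class (c : 'I_n) (z : nat) (h : int) :
    f (c%:Z + 1) = i + z%:Z + h * n%:Z -> g (i + z%:Z) = ix c (- h).
  by move=> e; rewrite /ix -[c%:Z + 1]fK e (periodicM _ _ inv_periodic); ring.
have cx := class _ _ _ ex; have cy := class _ _ _ ey.
have nxy : x != y.
  by apply: contra nab => /eqP exy; move: cx; rewrite exy cy => /ix_inj[->].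
have H : (x < 2)%N && (y < 2)%N = false.
  apply/negP => /andP[x2 y2].
  have [[x0 y1]|[x1 y0]] : (x = 0 /\ y = 1) \/ (x = 1 /\ y = 0) by lia.
    move/eqP: n1; apply; move: cx cy; rewrite x0 y1 addr0 eA eB.
    by move=> /ix_inj[-> _] /ix_inj[-> _].
  move/eqP: n2; apply; move: cx cy; rewrite x1 y0 addr0 eA eB.
  by move=> /ix_inj[-> _] /ix_inj[-> _].
by rewrite ex ey !sfun_rep // !divz_diff ?flip01_lt // flip01_ltE.
Qed.

(** Left multiplication by s_i at an ascent creates one inversion, that of the preimages of [i] and
    [i + 1]. With [rho] constantly 1 this computes the length, with the ratios (Y_i - Y_j) / f_ij
    the leading coefficient. *)
Lemma invprod_step i : g i < g (i + 1) ->
  invprod (sfun n i \o f) = op (rho (g i) (g (i + 1))) (invprod f).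
Proof.
have [A [kA eA]] := ixP (g i); have [B [kB eB]] := ixP (g (i + 1)).
move=> asc.
have fA : f (A%:Z + 1) = i - kA * n%:Z.
  by rewrite -[i]gK eA /ix -mulNr -(periodicM _ _ pf); congr f; ring.
have fB : f (B%:Z + 1) = i + 1 - kB * n%:Z.
  by rewrite -[i + 1]gK eB /ix -mulNr -(periodicM _ _ pf); congr f; ring.
have nAB : A != B.
  apply/eqP => e; move: fB; rewrite -e fA => h.
  by have [|] := lerP kB kA; nia.
have sA : (sfun n i \o f) (A%:Z + 1) = i + 1 - kA * n%:Z.
  by rewrite /= fA -mulNr periodicM ?sfunl //; exact: sfun_periodic.
have sB : (sfun n i \o f) (B%:Z + 1) = i - kB * n%:Z.
  by rewrite /= fB -mulNr periodicM ?sfunr //; exact: sfun_periodic.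
(* [p0] is the pair of [A] and [B] in increasing order; all other slopes are unchanged. *)
have key (p0 : 'I_n * 'I_n) : (p0 == (A, B)) || (p0 == (B, A)) -> (p0.1 < p0.2)%N ->
   invterm (p0.1%:Z + 1) (p0.2%:Z + 1) (pairslope (sfun n i \o f) p0.1 p0.2) =
   op (rho (g i) (g (i + 1))) (invterm (p0.1%:Z + 1) (p0.2%:Z + 1) (pairslope f p0.1 p0.2)) ->
   invprod (sfun n i \o f) = op (rho (g i) (g (i + 1))) (invprod f).
  move=> cp0 lt0 e0; rewrite /invprod (bigD1 p0) //= [in RHS](bigD1 p0) //= e0.
  rewrite Monoid.mulmA; congr (op _ _); apply: eq_bigr => -[a b] /= /andP[ltab npp].
  congr (invterm _ _ _); apply: pairslope_far eA eB _ _ _.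
  - by rewrite neq_ltn ltab.
  - by apply: contra npp => /eqP[ea eb]; case/orP: cp0 => /eqP e; move: lt0;
       rewrite e /= -ea -eb ?eqxx //; lia.
  - by apply: contra npp => /eqP[ea eb]; case/orP: cp0 => /eqP e; move: lt0;
       rewrite e /= -ea -eb ?eqxx //; lia.
have ltA := ltn_ord A; have ltB := ltn_ord B.
rewrite eA eB /ix in asc.
case: (ltngtP A B) => ltAB; last by move/eqP: nAB; case; apply: val_inj.
  (* The slope drops from -c to -c - 1, which adds the pair with index j = c. *)
  apply: (key (A, B)); rewrite ?eqxx //= /pairslope sA sB fA fB.
  have kAB : kA <= kB by nia.
  rewrite (_ : i - kB * n%:Z - (i + 1 - kA * n%:Z) = n.-1%:Z + (kA - kB - 1) * n%:Z); last first.
    have e : n.-1%:Z = n%:Z - 1 by lia.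
    by rewrite e; ring.
  rewrite (_ : i + 1 - kB * n%:Z - (i - kA * n%:Z) = 1%:Z + (kA - kB) * n%:Z); last by ring.
  rewrite !divz_small_add //; last by lia.
  have [c ec] : exists c : nat, kB - kA = c by exists (absz (kB - kA)%R); lia.
  have -> : kA - kB = - c%:Z by lia.
  have -> : - c%:Z - 1 = Negz c by lia.
  rewrite eA eB /ix (_ : kB = c%:Z + kA); last by lia.
  rewrite mulrDl addrA rho_shiftM /= big_nat_recr //= Monoid.mulmC; congr (op _ _).
  by case: c {ec} => [|c]; [rewrite oppr0 /= !big_geq | rewrite -NegzE].
(* Here the slope rises from c to c + 1, and the new pair has index j = c + 1. *)
apply: (key (B, A)); rewrite ?eqxx ?orbT //= /pairslope sA sB fA fB.
have kAB : kA + 1 <= kB by nia.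
rewrite (_ : i - kA * n%:Z - (i + 1 - kB * n%:Z) = n.-1%:Z + (kB - kA - 1) * n%:Z); last first.
  have e : n.-1%:Z = n%:Z - 1 by lia.
    by rewrite e; ring.
rewrite (_ : i + 1 - kA * n%:Z - (i - kB * n%:Z) = 1%:Z + (kB - kA) * n%:Z); last by ring.
rewrite !divz_small_add //; last by lia.
have [c ec] : exists c : nat, kB - kA - 1 = c by exists (absz (kB - kA - 1)%R); lia.
rewrite ec (_ : kB - kA = c.+1%:Z); last by lia.
rewrite /= [in LHS]big_nat_recr //= Monoid.mulmC; congr (op _ _).
rewrite eA eB /ix (_ : A%:Z + 1 + kA * n%:Z = A%:Z + 1 - c.+1%:Z * n%:Z + kB * n%:Z).
  by rewrite rho_shiftM.
by rewrite (_ : kB = c.+1%:Z + kA); [ring | lia].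
Qed.

End InversionProduct.
End AffinePermutations.

(** * Length as the number of inversions, and reduced words *)

Section Length.
Variable n : nat.
Hypothesis n_gt1 : (1 < n)%N.
Local Notation word := (seq (letter n)).

Definition ilen (f : int -> int) : nat := invprod n addn (fun _ _ => 1%N) f.

(** Left ascent: words grow at the head, so the test is on the inverse permutation. *)
Definition iasc (wd : word) (i : 'I_n) : bool :=
  wfun (winv wd) i%:Z < wfun (winv wd) (i%:Z + 1).

(** A letter s_i followed by the word v gets the root (v^-1 i, v^-1 (i+1)): the indices that
    f_(i,i+1) acquires when it is moved to the right past v. *)
Fixpoint wroots (wd : word) : seq (int * int) :=
  if wd is l :: w then
    if l is inl i then (wfun (winv w) i%:Z, wfun (winv w) (i%:Z + 1)) :: wroots w
    else wroots w
  else [::].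

Lemma winv_consE l (wd : word) i : wfun (winv (l :: wd)) i = wfun (winv wd) (lfun (linv l) i).
Proof. by rewrite winv_cons wfun_cat. Qed.

Lemma ilen_asc (wd : word) i : iasc wd i ->
  ilen (wfun (inl i :: wd)) = (ilen (wfun wd)).+1.
Proof.
move=> asc; rewrite /ilen.
by rewrite (invprod_step n_gt1 _ (rho := fun _ _ => 1%N) (g := wfun (winv wd)) _
   (wfun_periodic n_gt1 wd) (wfunK n_gt1 wd) (wfunVK n_gt1 wd)).
Qed.

Lemma wfun_neq (wd : word) i : wfun wd i != wfun wd (i + 1).
Proof. by apply/eqP => /(can_inj (wfunK n_gt1 wd)); lia. Qed.

Lemma iasc_flip (wd : word) i : iasc (inl i :: wd) i = ~~ iasc wd i.
Proof.
rewrite /iasc !winv_consE /= sfunl // sfunr // -leNgt.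
by rewrite le_eqVlt eq_sym (negPf (wfun_neq _ _)).
Qed.

Lemma ilen_desc (wd : word) i : ~~ iasc wd i ->
  ilen (wfun wd) = (ilen (wfun (inl i :: wd))).+1.
Proof.
rewrite -iasc_flip => /ilen_asc <-.
by apply: invprod_ext => j /=; rewrite sfunK.
Qed.

Lemma invprod_inr V idx (op : Monoid.com_law idx) (rho : int -> int -> V) (wd : word) b :
  invprod n op rho (wfun (inr b :: wd)) = invprod n op rho (wfun wd).
Proof. by case: b; exact: invprod_shift. Qed.

Lemma invprod_id V idx (op : Monoid.com_law idx) (rho : int -> int -> V) :
  invprod n op rho id = idx.
Proof.
rewrite /invprod big1 // => -[a b] /= lab; rewrite /pairslope /=.
have -> : (b%:Z + 1 - (a%:Z + 1)) = (b - a)%N%:Z + 0 * n%:Z.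
  by rewrite -subzn; [ring | exact: ltnW].
rewrite divz_small_add //= ?big_geq //.
by have := ltn_ord b; lia.
Qed.

Lemma ilen_le (wd : word) : (ilen (wfun wd) <= scount wd)%N.
Proof.
elim: wd => [|[i|b] wd IH]; first by rewrite /= /ilen invprod_id.
  rewrite scount_cons; case asc: (iasc wd i); first by rewrite ilen_asc // ltnS.
  by apply: leq_trans (leq_trans IH (leqnSn _)); rewrite ltnW // -ilen_desc ?asc.
by rewrite scount_cons /ilen invprod_inr.
Qed.

Lemma shift_word (d : int) : exists wd : word, scount wd = 0%N /\ wfun wd =1 (fun i => i + d).
Proof.
case: d => k; [exists (nseq k (inr true)) | exists (nseq k.+1 (inr false))].
  elim: k => [|k [IHc IHw]]; first by split=> // i; rewrite addr0.
  by split=> // i; rewrite /= IHw; lia.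
rewrite NegzE; elim: k => [|k [IHc IHw]]; first by split=> // i /=; lia.
by split=> // i; rewrite [LHS]/= -[X in X - 1]/(wfun (nseq k.+1 (inr false)) i) IHw; lia.
Qed.

(** Each of the n steps from 0 to n raises the inverse by at least 1, and by periodicity they raise
    it by n in total; so every step is exactly 1. *)
Lemma asc_shift (wd : word) : (forall i, iasc wd i) ->
  exists d, wfun (winv wd) =1 (fun i => i + d).
Proof.
move=> asc; set g := wfun (winv wd).
have pg : periodic n g := wfun_periodic n_gt1 _.
have up k : (k < n)%N -> g k%:Z + 1 <= g (k%:Z + 1).
  by move=> lk; have := asc (Ordinal lk); rewrite /iasc /= -/g; lia.
have lo k : (k <= n)%N -> g 0 + k%:Z <= g k%:Z.
  elim: k => [|k IH] lk; first by rewrite addr0.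
  by have := up _ lk; have := IH (ltnW lk); rewrite (_ : k.+1%:Z = k%:Z + 1); lia.
have hi k : (k <= n)%N -> g (n - k)%N%:Z + k%:Z <= g n%:Z.
  elim: k => [|k IH] lk; first by rewrite subn0 addr0.
  have := up (n - k.+1)%N; rewrite (_ : (n - k.+1)%N%:Z + 1 = (n - k)%N%:Z); last by lia.
  by have := IH (ltnW lk); lia.
have gn : g n%:Z = g 0 + n%:Z by rewrite -pg add0r.
exists (g 0) => i; have [a [k [la ->]]] := repP n_gt1 0 i.
rewrite add0r (periodicM _ _ pg).
have := lo a (ltnW la); have := hi (n - a)%N (leq_subr _ _).
by rewrite subKn 1?ltnW // gn; lia.
Qed.

(** Descents are removed one at a time; an element without descents is a power of pi, of length
    0. *)
Lemma ilen_word (wd : word) : exists wr : word, wfun wr =1 wfun wd /\ scount wr = ilen (wfun wd).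
Proof.
elim: {wd}_.+1 {-2}wd (ltnSn (ilen (wfun wd))) => // m IH wd lm.
case: (boolP [forall i, iasc wd i]) => [/forallP asc|].
  have [d ed] := asc_shift asc; have [wr [c0 er]] := shift_word (- d).
  have e : wfun wr =1 wfun wd.
    by move=> i; rewrite er -{1}(wfunK n_gt1 wd i) ed addrK.
  exists wr; split=> //; have := ilen_le wr; rewrite c0.
  by rewrite (_ : ilen (wfun wr) = ilen (wfun wd)); [lia | exact: invprod_ext].
rewrite negb_forall => /existsP[i dsc].
have e := ilen_desc dsc.
have [|wr [ew ec]] := IH (inl i :: wd); first by rewrite -ltnS -e.
exists (inl i :: wr); split; last by rewrite scount_cons ec e.
by move=> j; rewrite /= ew /= sfunK.
Qed.

Lemma reducedE (wd : word) : reduced wd <-> scount wd = ilen (wfun wd).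
Proof.
split=> [rd|e wd' /(wvalP n_gt1) ew]; last first.
  by rewrite e (_ : ilen _ = ilen (wfun wd')) ?ilen_le //; apply: invprod_ext => i; rewrite ew.
have [wr [ew ec]] := ilen_word wd; apply/eqP; rewrite eqn_leq ilen_le andbT -ec.
by apply: rd; apply/wvalP.
Qed.

Lemma reduced_inl i (wd : word) : reduced (inl i :: wd) <-> reduced wd /\ iasc wd i.
Proof.
rewrite !reducedE scount_cons; case asc: (iasc wd i).
  by rewrite ilen_asc //; split=> [[]|[->]].
split=> [|[]//]; have := ilen_desc (negbT asc); have := ilen_le wd; lia.
Qed.

Lemma reduced_inr b (wd : word) : reduced (inr b :: wd) <-> reduced wd.
Proof. by rewrite !reducedE scount_cons add0n /ilen invprod_inr. Qed.

Lemma reduced_cons l (wd : word) : reduced (l :: wd) -> reduced wd.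
Proof. by case: l => [i /reduced_inl[]|b /reduced_inr]. Qed.

Lemma reduced_nil : reduced ([::] : word).
Proof. by move=> wd' _. Qed.

Lemma exists_reduced (wd : word) : exists wr : word, reduced wr /\ wfun wr =1 wfun wd.
Proof.
have [wr [ew ec]] := ilen_word wd; exists wr; split=> //.
by apply/reducedE; rewrite ec; apply: invprod_ext => i; rewrite ew.
Qed.

Lemma reduced_scount (w1 w2 : word) : reduced w1 -> reduced w2 -> wfun w1 =1 wfun w2 ->
  scount w1 = scount w2.
Proof. by move=> /reducedE -> /reducedE -> e; exact: invprod_ext. Qed.

Lemma iasc_ext (w1 w2 : word) i : wfun w1 =1 wfun w2 -> iasc w1 i = iasc w2 i.
Proof. by move=> e; rewrite /iasc !(winv_ext n_gt1 e). Qed.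

Lemma reduced_desc (wd : word) i : reduced wd -> ~~ iasc wd i ->
  exists wr : word, reduced (inl i :: wr) /\ wfun (inl i :: wr) =1 wfun wd.
Proof.
move=> rd dsc; have [wr [rr er]] := exists_reduced (inl i :: wd).
exists wr; split; last by move=> j /=; rewrite er /= sfunK.
by apply/reduced_inl; split=> //; rewrite (iasc_ext _ er) iasc_flip.
Qed.

(** The left side is read off the word and the right side depends on the permutation only, so
    products over the roots agree for all reduced words of one element. *)
Lemma roots_invprod V idx (op : Monoid.com_law idx) (rho : int -> int -> V) (wd : word) :
    (forall i j, rho (i + n%:Z) (j + n%:Z) = rho i j) -> reduced wd ->
  \big[op/idx]_(p <- wroots wd) rho p.1 p.2 = invprod n op rho (wfun wd).
Proof.
move=> hrho; elim: wd => [|[i|b] wd IH] rd; first by rewrite big_nil invprod_id.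
  have [rw asc] := (reduced_inl i wd).1 rd.
  rewrite big_cons IH // (invprod_step n_gt1 _ (g := wfun (winv wd)) _
   (wfun_periodic n_gt1 wd) (wfunK n_gt1 wd) (wfunVK n_gt1 wd)) //.
by rewrite invprod_inr; apply/IH/(reduced_inr b).
Qed.

End Length.

(** * The localized coefficients and their values at the point *)

Lemma mpoly_ind_gen (R : comNzRingType) n (P : {mpoly R[n]} -> Prop) :
    (forall c, P c%:MP) -> (forall i, P 'X_i) ->
    (forall p q, P p -> P q -> P (p + q)) -> (forall p q, P p -> P q -> P (p * q)) ->
  forall p, P p.
Proof.
move=> PC PX PD PM p; rewrite (mpolyE p).
have P0 : P 0 by rewrite -mpolyC0.
have P1 : P 1 by rewrite -mpolyC1.
elim/big_rec: _ => // m q _ Pq; apply: PD => //; rewrite -mul_mpolyC; apply: (PM _ _) => //.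
rewrite mpolyXE_id; elim/big_rec: _ => // i {}q _ {}Pq; apply: (PM _ _) => //.
by elim: (m i) => [|k IH]; rewrite ?expr0 // exprS; exact: PM.
Qed.

Lemma tofrac_divP (R : idomainType) (a b c d : R) : b != 0 -> d != 0 ->
  a%:F / b%:F = c%:F / d%:F <-> a * d = c * b.
Proof.
move=> b0 d0; split=> [/eqP|e].
  by rewrite eqr_div ?tofrac_eq0 // -!tofracM tofrac_eq => /eqP.
by apply/eqP; rewrite eqr_div ?tofrac_eq0 // -!tofracM e.
Qed.

Section Coefficients.
Variables (K : fieldType) (n : nat) (t : K).
Hypothesis n_gt1 : (1 < n)%N.
Hypothesis t_neq0 : t != 0.
Local Notation P := {mpoly K[n]}.
Local Notation F := {fraction P}.
Local Notation Y i := (Yext n t i).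
Local Notation f := (fY n t).
Local Notation q := (qq t).

Lemma qq_neq0 : q != 0. Proof. by rewrite invr_eq0 expf_eq0. Qed.

Lemma Yext_ix (r : 'I_n) m : Y (ix r m) = q ^ (- m) *: 'X_r.
Proof. by rewrite /Yext ix_div // ix_mod // absz_nat valK. Qed.

Lemma Yext_shift i m : Y (i + m * n%:Z) = q ^ (- m) *: Y i.
Proof.
have [r [k ->]] := ixP n_gt1 i.
have -> : ix r k + m * n%:Z = ix r (k + m) by rewrite /ix; ring.
by rewrite !Yext_ix scalerA -expfzDr ?qq_neq0 // opprD addrC.
Qed.

Lemma fY_shift i j m : f (i + m * n%:Z) (j + m * n%:Z) = q ^ (- m) *: f i j.
Proof. by rewrite /fY !Yext_shift scalerBr !scalerA ![q ^ _ * _]mulrC. Qed.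

Lemma periodic_mod (s g : int -> int) i j : periodic n s -> cancel s g ->
  ((i %% n%:Z)%Z != (j %% n%:Z)%Z) -> ((s i %% n%:Z)%Z != (s j %% n%:Z)%Z).
Proof.
move=> ps sK; apply: contra => /eqP e.
have [a [k [la ea]]] := repP n_gt1 0 (s i); have [b [l [lb eb]]] := repP n_gt1 0 (s j).
move: e; rewrite ea eb !add0r !modz_small_add // => -[eab].
have -> : i = j + (k - l) * n%:Z.
  apply: (can_inj sK); rewrite periodicM // ea eb eab; ring.
by rewrite addrC modzMDl.
Qed.

Lemma mod_ix (r : 'I_n) m : ((ix r m %% n%:Z)%Z = ((r.+1) %% n)%N).
Proof. by rewrite /ix addrC modzMDl -PoszD addn1 modz_nat. Qed.

Lemma mod_ix_neq (r r' : 'I_n) m m' :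
  ((ix r m %% n%:Z)%Z != (ix r' m' %% n%:Z)%Z) = (r != r').
Proof.
rewrite !mod_ix; congr (~~ _); apply/eqP/eqP => [[]|->//].
move=> e; apply: val_inj => /=.
by have /eqP := e; rewrite -(addn1 r) -(addn1 r') eqn_modDr !modn_small // => /eqP.
Qed.

Lemma fY_ix (r r' : 'I_n) m m' :
  f (ix r m) (ix r' m') = (t * q ^ (- m)) *: 'X_r - (t^-1 * q ^ (- m')) *: 'X_r'.
Proof. by rewrite /fY !Yext_ix !scalerA. Qed.

Lemma fY_neq0 i j : ((i %% n%:Z)%Z != (j %% n%:Z)%Z) -> f i j != 0.
Proof.
have [r [m ->]] := ixP n_gt1 i; have [r' [m' ->]] := ixP n_gt1 j.
rewrite mod_ix_neq fY_ix => nrr; apply/eqP => /(congr1 (mcoeff U_(r)%MM)).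
rewrite mcoeffB !mcoeffZ !mcoeffXU eqxx eq_sym (negPf nrr) mulr1 mulr0 subr0 mcoeff0.
by apply/eqP; rewrite mulf_neq0 ?expfz_neq0 ?qq_neq0.
Qed.

Lemma mpolyXU_neq0 (k : 'I_n) : 'X_k != 0 :> P.
Proof.
by apply/eqP => /(congr1 (mcoeff U_(k)%MM)); rewrite mcoeffXU eqxx mcoeff0 => /eqP; rewrite oner_eq0.
Qed.

(* Admissible denominators up to a nonzero scalar: this class, unlike [adm_denom], *)
(* is stable under the action of affine permutations.                              *)
Definition adm (d : P) : Prop :=
  exists c d', [/\ c != 0, adm_denom t d' & d = c *: d'].

Lemma admE d : adm_denom t d -> adm d.
Proof. by exists 1, d; rewrite oner_neq0 scale1r. Qed.

Lemma adm1 : adm 1.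
Proof. by apply: admE; exists [::]; rewrite big_nil. Qed.

Lemma admM d e : adm d -> adm e -> adm (d * e).
Proof.
move=> [c [_ [nc [s [hs ->]] ->]]] [c' [_ [nc' [s' [hs' ->]] ->]]].
exists (c * c'), (\prod_(p <- s ++ s') p); split; first by rewrite mulf_neq0.
  by exists (s ++ s'); split=> // p; rewrite mem_cat => /orP[/hs|/hs'].
by rewrite big_cat /= -scalerAl -scalerAr scalerA.
Qed.

Lemma admZ c d : c != 0 -> adm d -> adm (c *: d).
Proof.
move=> nc [c' [d' [nc' hd ->]]]; exists (c * c'), d'; split=> //; first by rewrite mulf_neq0.
by rewrite scalerA.
Qed.

Lemma adm_factor p : denom_factor t p -> adm p.
Proof.
move=> hp; apply: admE; exists [:: p]; rewrite big_seq1; split=> // x.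
by rewrite inE => /eqP ->.
Qed.

Lemma adm_fY i j : ((i %% n%:Z)%Z != (j %% n%:Z)%Z) -> adm (f i j).
Proof. by move=> hij; apply: adm_factor; right; exists i, j. Qed.

Lemma adm_Yext i : adm (Y i).
Proof.
have [r [m ->]] := ixP n_gt1 i; rewrite Yext_ix.
by apply: admZ; rewrite ?expfz_neq0 ?qq_neq0 //; apply: adm_factor; left; exists r.
Qed.

Lemma adm_ind (Q : P -> Prop) :
    (forall c, c != 0 -> Q c%:MP) -> (forall k, Q 'X_k) ->
    (forall i j, ((i %% n%:Z)%Z != (j %% n%:Z)%Z) -> Q (f i j)) ->
    (forall p r, Q p -> Q r -> Q (p * r)) ->
  forall d, adm d -> Q d.
Proof.
move=> QC QX Qf QM d [c [d' [nc [s [hs ->]] ->]]].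
rewrite -mul_mpolyC; apply: (QM _ _); first exact: QC.
elim: s hs => [|p s IH] hs; first by rewrite big_nil -mpolyC1; apply: (QC _); exact: oner_neq0.
rewrite big_cons; apply: (QM _ _); last by apply: IH => x hx; apply: hs; rewrite inE hx orbT.
by have [[k ->]|[i [j [nij ->]]]] := hs p (mem_head _ _); [exact: QX | exact: Qf].
Qed.

Lemma adm_neq0 d : adm d -> d != 0.
Proof.
elim/adm_ind: d / => [c nc|k|i j|p r]; last exact: mulf_neq0.
- by rewrite mpolyC_eq0.
- exact: mpolyXU_neq0.
- exact: fY_neq0.
Qed.

(** The substitution of Y_(s i) for Y_i. It keeps polynomials polynomial, as translating an index by
    n only rescales the variable by a power of q. *)
Definition act (s : int -> int) (p : P) : P :=
  comp_mpoly [tuple Y (s (k%:Z + 1)) | k < n] p.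

Lemma actD s p r : act s (p + r) = act s p + act s r.
Proof. exact: comp_mpolyD. Qed.

Lemma actB s p r : act s (p - r) = act s p - act s r.
Proof. exact: comp_mpolyB. Qed.

Lemma actM s p r : act s (p * r) = act s p * act s r.
Proof. exact: (rmorphM (comp_mpoly _)). Qed.

Lemma actC s c : act s c%:MP = c%:MP.
Proof. exact: comp_mpolyC. Qed.

Lemma actZ s c p : act s (c *: p) = c *: act s p.
Proof. exact: comp_mpolyZ. Qed.

Lemma actX s (k : 'I_n) : act s 'X_k = Y (s (k%:Z + 1)).
Proof. by rewrite /act comp_mpolyXU -tnth_nth tnth_mktuple. Qed.

Lemma ix0 (k : 'I_n) : k%:Z + 1 = ix k 0.
Proof. by rewrite /ix mul0r addr0. Qed.

Lemma Yext0 (k : 'I_n) : Y (k%:Z + 1) = 'X_k.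
Proof. by rewrite ix0 Yext_ix oppr0 expr0z scale1r. Qed.

Lemma actY s i : periodic n s -> act s (Y i) = Y (s i).
Proof.
move=> ps; have [r [m ->]] := ixP n_gt1 i.
by rewrite Yext_ix actZ actX /ix periodicM // Yext_shift.
Qed.

Lemma act_fY s i j : periodic n s -> act s (f i j) = f (s i) (s j).
Proof. by move=> ps; rewrite /fY actB (actZ _ t) (actZ _ t^-1) !actY. Qed.

Lemma act_comp s u p : periodic n s -> act s (act u p) = act (s \o u) p.
Proof.
move=> ps; elim/mpoly_ind_gen: p => [c|i|p r IHp IHr|p r IHp IHr].
- by rewrite !actC.
- by rewrite !actX actY.
- by rewrite !actD IHp IHr.
- by rewrite !actM IHp IHr.
Qed.

Lemma act_ext s u p : s =1 u -> act s p = act u p.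
Proof.
move=> e; rewrite /act; congr (comp_mpoly _ _).
by apply: eq_from_tnth => k; rewrite !tnth_mktuple e.
Qed.

Lemma act_id p : act id p = p.
Proof.
elim/mpoly_ind_gen: p => [c|i|p r IHp IHr|p r IHp IHr].
- by rewrite actC.
- by rewrite actX Yext0.
- by rewrite actD IHp IHr.
- by rewrite actM IHp IHr.
Qed.

Lemma adm_act s g d : periodic n s -> cancel s g -> adm d -> adm (act s d).
Proof.
move=> ps sK; elim/adm_ind: d / => [c nc|k|i j nij|p r]; last by rewrite actM; exact: admM.
- by rewrite actC -[c%:MP]mulr1 mul_mpolyC; apply: admZ => //; exact: adm1.
- by rewrite actX; exact: adm_Yext.
- by rewrite act_fY //; apply: adm_fY; exact: periodic_mod sK nij.
Qed.

Local Notation inK := (@inKY K n t).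

(** The scalar by which [adm] differs from [adm_denom] is absorbed into the numerator. *)
Lemma inKP g : inK g <-> exists a d, adm d /\ g = a%:F / d%:F.
Proof.
split=> [[a [d [hd ->]]]|[a [d' [[c [d [nc hd ->]]] ->]]]].
  by exists a, d; split=> //; exact: admE.
exists (c^-1 *: a), d; split=> //; apply/eqP.
have d0 := adm_neq0 (admE hd).
rewrite eqr_div ?tofrac_eq0 ?scaler_eq0 ?(negPf nc) // -!tofracM.
by rewrite -scalerAr -scalerAl scalerA divff // scale1r.
Qed.

Lemma inK_frac a d : adm d -> inK (a%:F / d%:F).
Proof. by move=> hd; apply/inKP; exists a, d. Qed.

Lemma inK_poly a : inK (a%:F).
Proof. by rewrite -[a%:F]divr1 -tofrac1; apply: inK_frac adm1. Qed.

Lemma tofrac_neq0 (p : P) : p != 0 -> p%:F != 0.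
Proof. by rewrite tofrac_eq0. Qed.

Lemma inKD g h : inK g -> inK h -> inK (g + h).
Proof.
move=> /inKP[a [d [hd ->]]] /inKP[b [e [he ->]]].
rewrite addf_div ?tofrac_neq0 ?adm_neq0 // -!tofracM -tofracD.
by apply: inK_frac; exact: admM.
Qed.

Lemma inKM g h : inK g -> inK h -> inK (g * h).
Proof.
move=> /inKP[a [d [hd ->]]] /inKP[b [e [he ->]]].
by rewrite mulf_div -!tofracM; apply: inK_frac; exact: admM.
Qed.

Local Notation ev_p := (meval (ptrho t : 'I_n -> K)).
Local Notation regular := (@no_pole K n t).

Lemma ev_neq0 (b : P) : ev_p b != 0 -> b != 0.
Proof. by apply: contraNneq => ->; rewrite meval0. Qed.

Lemma regular_frac (a b : P) : ev_p b != 0 -> regular (a%:F / b%:F).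
Proof. by exists a, b. Qed.

Lemma regular_poly (a : P) : regular a%:F.
Proof. by rewrite -[a%:F]divr1 -tofrac1; apply: regular_frac; rewrite meval1 oner_neq0. Qed.

Lemma regularD g h : regular g -> regular h -> regular (g + h).
Proof.
move=> [a [b [nb ->]]] [c [d [nd ->]]]; rewrite addf_div ?tofrac_neq0 ?ev_neq0 //.
by rewrite -!tofracM -tofracD; apply: regular_frac; rewrite mevalM mulf_neq0.
Qed.

Lemma regularM g h : regular g -> regular h -> regular (g * h).
Proof.
move=> [a [b [nb ->]]] [c [d [nd ->]]]; rewrite mulf_div -!tofracM.
by apply: regular_frac; rewrite mevalM mulf_neq0.
Qed.

Definition inKreg (g : F) := inK g /\ regular g.

Lemma inKregD g h : inKreg g -> inKreg h -> inKreg (g + h).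
Proof. by move=> [? ?] [? ?]; split; [exact: inKD | exact: regularD]. Qed.

Lemma inKregM g h : inKreg g -> inKreg h -> inKreg (g * h).
Proof. by move=> [? ?] [? ?]; split; [exact: inKM | exact: regularM]. Qed.

Lemma inKreg_poly a : inKreg a%:F.
Proof. by split; [exact: inK_poly | exact: regular_poly]. Qed.

(* The exponent for which Y_i takes the value t^(2 expo i) at the point. *)
Definition expo (i : int) : int := ((i - 1) %/ n%:Z)%Z - ((i - 1) %% n%:Z)%Z.

Lemma expo_ix (r : 'I_n) m : expo (ix r m) = m - r%:Z.
Proof. by rewrite /expo ix_div // ix_mod. Qed.

Lemma ev_Yext i : ev_p (Y i) = (t ^+ 2) ^ (expo i).
Proof.
have [r [m ->]] := ixP n_gt1 i.
rewrite Yext_ix expo_ix mevalZ mevalXU /ptrho expfzDr ?expf_neq0 //.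
by congr (_ * _); [rewrite /qq exprz_inv opprK | rewrite exprM exprnN].
Qed.

(** The value of Y_i at the point depends on [expo i] alone, so [s] fixes the point. *)
Lemma ev_act s p : (forall i, expo (s i) = expo i) -> ev_p (act s p) = ev_p p.
Proof.
move=> hs; rewrite /act comp_mpoly_meval; apply: meval_eq => k.
by rewrite tnth_mktuple ev_Yext hs -ev_Yext Yext0 mevalXU.
Qed.

Hypothesis t_nroot : forall m : nat, (0 < m)%N -> t ^+ m != 1.

Lemma expz_inj (a b : int) : (t ^+ 2) ^ a = (t ^+ 2) ^ b -> a = b.
Proof.
wlog lab : a b / a <= b => [H e|].
  by case: (lerP a b) => [/H/(_ e)//|/ltW/H/(_ (esym e))/esym].
move=> e; apply/eqP/negPn/negP => nab.
have [k [k0 ek]] : exists k : nat, (0 < k)%N /\ b = a + k%:Z.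
  by exists (absz (b - a)%R); lia.
have /eqP := e; rewrite ek expfzDr ?expf_neq0 // -[X in X == _]mulr1.
rewrite (inj_eq (mulfI _)) ?expfz_neq0 ?expf_neq0 // -exprnP -exprM eq_sym.
by rewrite (negPf (t_nroot _)) // muln_gt0.
Qed.

(** At the point f_ij equals t^-1 (t^(2 (expo i + 1)) - t^(2 expo j)), and t is not a root of
    unity. *)
Lemma ev_fY i j : (ev_p (f i j) == 0) = (expo i + 1 == expo j).
Proof.
rewrite /fY mevalB (mevalZ _ t) (mevalZ _ t^-1) !ev_Yext.
have -> : t * (t ^+ 2) ^ expo i = t^-1 * (t ^+ 2) ^ (expo i + 1).
  by rewrite expfzDr ?expf_neq0 // expr1z expr2; field.
rewrite -mulrBr mulf_eq0 invr_eq0 (negPf t_neq0) /= subr_eq0.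
by apply/eqP/eqP => [/expz_inj|->].
Qed.

Lemma Yext_inj i j : Y i = Y j -> i = j.
Proof.
have [r [m ->]] := ixP n_gt1 i; have [r' [m' ->]] := ixP n_gt1 j.
rewrite !Yext_ix => e; have /(congr1 (mcoeff U_(r)%MM)) := e.
rewrite !mcoeffZ !mcoeffXU eqxx mulr1; case: eqP => [->|_].
  rewrite mulr1 /qq !exprz_inv !opprK.
  by move=> /expz_inj ->.
by rewrite mulr0 => /eqP; rewrite expfz_eq0 (negPf qq_neq0) andbF.
Qed.

End Coefficients.

(** * Commutation of the T_i with the Y_j, and the intertwiners *)

Section Intertwiners.
Variables (K : fieldType) (n : nat) (t : K).
Hypothesis n_gt1 : (1 < n)%N.
Hypothesis t_neq0 : t != 0.
Local Notation P := {mpoly K[n]}.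
Local Notation F := {fraction P}.
Local Notation Y i := (Yext n t i).
Local Notation f := (fY n t).
Local Notation q := (qq t).
Local Notation word := (seq (letter n)).
Local Notation adm := (@adm K n t).
Local Notation inK := (@inKY K n t).
Local Notation act := (@act K n t).
Local Notation c := (t - t^-1).

Variables (A : algType K) (T : 'I_n -> A) (pi piinv : A).
Variables (ev : {rmorphism P -> A}) (iota : F -> A).
Hypothesis hrel : daha_relations t T pi piinv ev.
Hypothesis hiota : iota_spec t ev iota.

Lemma evC k : ev k%:MP = k%:A. Proof. by case: hrel => ->. Qed.

Lemma evZ k p : ev (k *: p) = k *: ev p.
Proof. by rewrite -mul_mpolyC rmorphM /= evC mulr_algl. Qed.

Lemma evCm p r : ev p * ev r = ev r * ev p.
Proof. by rewrite -!(rmorphM ev) mulrC. Qed.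

Lemma unitA_mul (a b : A) : is_unit_A a -> is_unit_A b -> is_unit_A (a * b).
Proof.
move=> [a' [l1 r1]] [b' [l2 r2]]; exists (b' * a'); split.
  by rewrite mulrA -(mulrA b') l1 mulr1.
by rewrite mulrA -(mulrA a) r2 mulr1.
Qed.

Lemma unitA_mulIr (u a b : A) : is_unit_A u -> a * u = b * u -> a = b.
Proof. by move=> [v [_ uv]] /(congr1 (fun z => z * v)); rewrite -!mulrA uv !mulr1. Qed.

Lemma ev_unit d : adm d -> is_unit_A (ev d).
Proof.
elim/adm_ind: d / => [k nk|k|i j nij|p r up ur].
- exists (k^-1%:A); rewrite evC; split; rewrite -scalerAl mul1r scalerA ?mulVf ?mulfV ?scale1r //.
- by case: hrel => _ [].
- by case: hiota => _; apply.
- by rewrite rmorphM; exact: unitA_mul.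
Qed.

Lemma Tz_ord (i : 'I_n) : Tz T i%:Z = T i.
Proof. by rewrite /Tz modz_small ?lez_nat ?ltz_nat ?ltn_ord //= valK. Qed.

Lemma T_quad i : T i * T i = c *: T i + 1.
Proof.
have [_ [_ [_ [/(_ i) h _]]]] := hrel.
move: h; rewrite mulrDr !mulrBl -!scalerAl -!scalerAr !mul1r !mulr1 scalerA divff // scale1r.
move=> h; apply/eqP; rewrite -subr_eq0 -[X in _ == X]h scalerBl !opprD opprK.
by rewrite !addrA.
Qed.

(** One formula for all i: for i = 0 the relation T_0 Y_n T_0 = q^-1 Y_1 is rewritten with Y_0 = q
    Y_n. *)
Lemma T_Y_T (i : 'I_n) : T i * ev (Y i) * T i = ev (Y (i%:Z + 1)).
Proof.
have [_ [_ [_ [_ [_ [_ [[h h0] _]]]]]]] := hrel.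
have [i0|i_gt0] := posnP i; last first.
  by have := h i; rewrite Tz_ord; apply; rewrite !lez_nat ltz_nat ltn_ord andbT.
have ei : i%:Z = 0 by rewrite i0.
have := h0; rewrite -ei Tz_ord ei /YA => e.
have -> : Y 0 = q *: Y n%:Z.
  have -> : 0 = n%:Z + (-1) * n%:Z by ring.
  by rewrite Yext_shift // opprK expr1z.
by rewrite add0r evZ -scalerAr -scalerAl e scalerA divff ?scale1r ?qq_neq0.
Qed.

Lemma T_Y_far (i : 'I_n) (a : nat) k : (1 < a < n)%N ->
  T i * ev (Y (i%:Z + a%:Z + k * n%:Z)) = ev (Y (i%:Z + a%:Z + k * n%:Z)) * T i.
Proof.
move=> /andP[a1 an].
have [_ [_ [_ [_ [_ [_ [_ [h _]]]]]]]] := hrel.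
have [r [m e]] := ixP n_gt1 (i%:Z + a%:Z + k * n%:Z).
have -> : Y (i%:Z + a%:Z + k * n%:Z) = q ^ (- m) *: Y (r%:Z + 1) by rewrite e Yext_shift.
rewrite evZ -scalerAr -scalerAl; congr (_ *: _).
have := h i (r%:Z + 1); rewrite Tz_ord /YA; apply; first by have := ltn_ord r; lia.
  have -> : r%:Z + 1 - i%:Z = a%:Z + (k - m) * n%:Z by rewrite /ix in e; rewrite mulrBl; lia.
  by rewrite modz_small_add //; lia.
have -> : r%:Z + 1 - i%:Z - 1 = a.-1%:Z + (k - m) * n%:Z.
  have -> : a.-1%:Z = a%:Z - 1 by lia.
  by rewrite /ix in e; rewrite mulrBl; lia.
by rewrite modz_small_add //; lia.
Qed.

Lemma pi_Y j : pi * ev (Y j) = ev (Y (j + 1)) * pi.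
Proof.
have [_ [_ [[p1 p2] [_ [_ [_ [_ [_ [h h0]]]]]]]]] := hrel.
suff e : pi * ev (Y j) * piinv = ev (Y (j + 1)) by rewrite -e -!mulrA p2 mulr1.
have [r [m ->]] := ixP n_gt1 j.
have -> : ix r m + 1 = r%:Z + 1 + 1 + m * n%:Z by rewrite /ix; ring.
rewrite /ix !Yext_shift // !(evZ (q ^ (- m))) -scalerAr -scalerAl; congr (_ *: _).
have := ltn_ord r; rewrite leq_eqVlt => /orP[/eqP e|lr].
  have -> : r%:Z + 1 = n%:Z by lia.
  have := h0; rewrite /YA => ->; rewrite -evZ; congr (ev _).
  have -> : n%:Z + 1 = 1 + 1 * n%:Z by ring.
  by rewrite Yext_shift.
by apply: h; lia.
Qed.

Lemma piinv_Y j : piinv * ev (Y j) = ev (Y (j - 1)) * piinv.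
Proof.
have [_ [_ [[p1 p2] _]]] := hrel.
have := pi_Y (j - 1); rewrite subrK => /(congr1 (fun z => piinv * z * piinv)).
by rewrite !mulrA p2 mul1r -(mulrA _ pi) p1 mulr1.
Qed.

Lemma Y_T_left (i : 'I_n) :
  ev (Y i) * T i = T i * ev (Y (i%:Z + 1)) - c *: ev (Y (i%:Z + 1)).
Proof.
rewrite -T_Y_T !mulrA T_quad !mulrDl mul1r -!scalerAl.
by rewrite addrAC subrr add0r.
Qed.

Lemma Y_T_right (i : 'I_n) :
  ev (Y (i%:Z + 1)) * T i = T i * ev (Y i) + c *: ev (Y (i%:Z + 1)).
Proof.
by rewrite -T_Y_T -mulrA T_quad mulrDr mulr1 -scalerAr addrC.
Qed.

Lemma sfun_cases (i j : int) :
  [\/ exists k, j = i + k * n%:Z /\ sfun n i j = i + 1 + k * n%:Z,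
      exists k, j = i + 1 + k * n%:Z /\ sfun n i j = i + k * n%:Z
    | exists a k, [/\ (1 < a < n)%N, j = i + a%:Z + k * n%:Z & sfun n i j = j]].
Proof.
have [a [k [la ->]]] := repP n_gt1 i j; rewrite sfun_rep //.
case: a la => [|[|a]] la; last by constructor 3; exists a.+2, k.
  by constructor 1; exists k; rewrite addr0.
by constructor 2; exists k; rewrite addr0.
Qed.

(** Lusztig's relation, recording of the correction only that it is a polynomial. *)
Lemma Y_T (i : 'I_n) j : exists e, ev (Y j) * T i = T i * ev (Y (sfun n i j)) + ev e.
Proof.
have [[k [-> ->]]|[k [-> ->]]|[a [k [la -> ->]]]] := sfun_cases i%:Z j.
- exists (- (q ^ (- k) *: (c *: Y (i%:Z + 1)))).
  rewrite !Yext_shift // rmorphN /= !(evZ (q ^ (- k))) (evZ c) -scalerAl -scalerAr -scalerBr.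
  by rewrite Y_T_left.
- exists (q ^ (- k) *: (c *: Y (i%:Z + 1))).
  rewrite !Yext_shift // !(evZ (q ^ (- k))) (evZ c) -scalerAl -scalerAr -scalerDr.
  by rewrite Y_T_right.
- by exists 0; rewrite rmorph0 addr0 T_Y_far.
Qed.

Definition phi (i : 'I_n) : A := T i * YA t ev i%:Z - YA t ev i%:Z * T i.

Lemma phiE (i : 'I_n) : phi i =
  T i * ev (Y i - Y (i%:Z + 1)) + ev (c *: Y (i%:Z + 1)).
Proof.
by rewrite /phi /YA Y_T_left rmorphB /= mulrBr (evZ c) opprB addrA addrAC.
Qed.

(** The correction from moving Y_j past T_i is compensated by the polynomial part of phi_i; the
    coefficient of T_i and the remaining term each reduce to a polynomial identity. *)
Lemma Y_phi (i : 'I_n) j : ev (Y j) * phi i = phi i * ev (Y (sfun n i j)).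
Proof.
rewrite phiE mulrDr mulrDl mulrA -!(mulrA (T i)) -!(rmorphM ev).
have [[k [-> ->]]|[k [-> ->]]|[a [k [la -> ->]]]] := sfun_cases i%:Z j.
- rewrite !Yext_shift // (evZ (q ^ (- k))) -scalerAl Y_T_left scalerBr mulrBl.
  rewrite scalerAr -!evZ -!mulrA -!(rmorphM ev) -addrA -(rmorphN ev) -(rmorphD ev).
  by congr (T i * ev _ + ev _); move: (Y i) (Y _) => y y'; rewrite -!mul_mpolyC ?mpolyCB; ring.
- rewrite !Yext_shift // (evZ (q ^ (- k))) -scalerAl Y_T_right scalerDr mulrDl.
  rewrite scalerAr -!evZ -!mulrA -!(rmorphM ev) -addrA -(rmorphD ev).
  by congr (T i * ev _ + ev _); move: (Y i) (Y _) => y y'; rewrite -!mul_mpolyC ?mpolyCB; ring.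
- rewrite -T_Y_far // -mulrA -!(rmorphM ev).
  by congr (T i * ev _ + ev _); ring.
Qed.

Definition philetter (l : letter n) : A :=
  match l with inl i => phi i | inr true => pi | inr false => piinv end.
Definition phiword (wd : word) : A := \prod_(l <- wd) philetter l.

(** The permutation acts on what comes out on the right, so nu_w and phi_w intertwine by w^-1 and
    products compose in reverse order. *)
Definition intertwines (h : A) (s : int -> int) :=
  forall p, ev p * h = h * ev (act s p).

Lemma intertwinesP h s : (forall j, ev (Y j) * h = h * ev (Y (s j))) -> intertwines h s.
Proof.
move=> hY p; elim/mpoly_ind_gen: p => [k|k|p r IHp IHr|p r IHp IHr].
- by rewrite actC evC -scalerAl mul1r -scalerAr mulr1.
- by rewrite actX -(Yext0 t n_gt1).
- by rewrite actD !rmorphD /= mulrDl mulrDr IHp IHr.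
- by rewrite actM !rmorphM /= -mulrA IHr mulrA IHp mulrA.
Qed.

Lemma intertwines_comp h1 h2 s1 s2 : periodic n s2 ->
  intertwines h1 s1 -> intertwines h2 s2 -> intertwines (h1 * h2) (s2 \o s1).
Proof. by move=> ps i1 i2 p; rewrite mulrA i1 -mulrA i2 act_comp // mulrA. Qed.

Lemma intertwines1 : intertwines 1 id.
Proof. by move=> p; rewrite act_id // mulr1 mul1r. Qed.

Lemma philetter_int l : intertwines (philetter l) (lfun (linv l)).
Proof.
apply: intertwinesP => j; case: l => [i|[]] /=; first exact: Y_phi.
  by rewrite pi_Y subrK.
by rewrite piinv_Y addrK.
Qed.

Lemma tofracV_mul (a d : P) : adm d -> a%:F / d%:F * d%:F = a%:F.
Proof. by move=> /(adm_neq0 n_gt1 t_neq0) nd; rewrite divfK ?tofrac_eq0. Qed.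

(** Any admissible denominator of [g] computes [iota g], not only the one exhibited by [inKY]; its
    image under [ev] is a unit, so this replaces division in [A]. *)
Lemma iotaE g a d : inK g -> adm d -> g * d%:F = a%:F -> iota g * ev d = ev a.
Proof.
move=> [a' [d' [hd ->]]] ad e.
have nd' := tofrac_neq0 (adm_neq0 n_gt1 t_neq0 (admE hd)).
apply: (unitA_mulIr (ev_unit (admE hd))); rewrite -mulrA evCm mulrA hiota.1 //.
rewrite -!(rmorphM ev); congr (ev _); apply/eqP; rewrite -tofrac_eq !tofracM -e.
by rewrite mulrAC divfK.
Qed.

Lemma iota_eqP g a d h : inK g -> adm d -> g * d%:F = a%:F -> h * ev d = ev a -> iota g = h.
Proof. by move=> ig ad e eh; apply: (unitA_mulIr (ev_unit ad)); rewrite eh (iotaE ig ad e). Qed.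

Lemma iota_poly p : iota p%:F = ev p.
Proof.
apply: (@iota_eqP _ p 1); [exact: inK_poly | exact: adm1 | |].
  by rewrite tofrac1 mulr1.
by rewrite rmorph1 mulr1.
Qed.

Lemma iota_add g h : inK g -> inK h -> iota (g + h) = iota g + iota h.
Proof.
move=> ig ih; have := (inKP n_gt1 t_neq0 g).1 ig => -[a [d [hd eg]]].
have := (inKP n_gt1 t_neq0 h).1 ih => -[b [e [he eh]]].
have ga : g * d%:F = a%:F by rewrite eg tofracV_mul.
have hb : h * e%:F = b%:F by rewrite eh tofracV_mul.
apply: (@iota_eqP _ (a * e + b * d) (d * e)); first exact: inKD.
- exact: admM.
- by rewrite tofracD !tofracM -ga -hb; ring.
rewrite rmorphD !rmorphM /= mulrDl; congr (_ + _).
  by rewrite mulrA (iotaE ig hd ga).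
by rewrite evCm mulrA (iotaE ih he hb).
Qed.

Lemma iota_mul g h : inK g -> inK h -> iota (g * h) = iota g * iota h.
Proof.
move=> ig ih; have := (inKP n_gt1 t_neq0 g).1 ig => -[a [d [hd eg]]].
have := (inKP n_gt1 t_neq0 h).1 ih => -[b [e [he eh]]].
have ga : g * d%:F = a%:F by rewrite eg tofracV_mul.
have hb : h * e%:F = b%:F by rewrite eh tofracV_mul.
apply: (@iota_eqP _ (a * b) (e * d)); first exact: inKM.
- exact: admM.
- by rewrite !tofracM -ga -hb; ring.
rewrite !rmorphM /= mulrA -(mulrA (iota g)) (iotaE ih he hb).
by rewrite -mulrA evCm mulrA (iotaE ig hd ga).
Qed.

(** Multiplication by the unit [ev (act s d)] reduces the claim to the intertwining of the
    polynomials [d] and [a]. *)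
Lemma iota_int h s s' a d : intertwines h s -> periodic n s -> cancel s s' -> adm d ->
  iota (a%:F / d%:F) * h = h * iota ((act s a)%:F / (act s d)%:F).
Proof.
move=> hh ps sK hd; have hd' := adm_act n_gt1 t_neq0 ps sK hd.
apply: (unitA_mulIr (ev_unit hd')).
rewrite -!mulrA -hh (iotaE (a := act s a)) //; last exact: tofracV_mul.
  by rewrite mulrA (iotaE (a := a)) //; [exact: inK_frac | exact: tofracV_mul].
exact: inK_frac.
Qed.

Local Notation nul := (nuletter t T pi piinv ev iota).
Local Notation nuw := (nuword t T pi piinv ev iota).

Lemma succ_mod_neq (i : int) : (i %% n%:Z)%Z != ((i + 1) %% n%:Z)%Z.
Proof.
by rewrite eq_sym eqz_mod_dvd addrC addKr dvdzE /= dvdn1 neq_ltn n_gt1 orbT.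
Qed.

Lemma fY_adm_succ i : adm (f i (i + 1)).
Proof. by apply: adm_fY; exact: succ_mod_neq. Qed.

Lemma fY_adm_pred i : adm (f (i + 1) i).
Proof. by apply: adm_fY; rewrite eq_sym; exact: succ_mod_neq. Qed.

Lemma nul_phi (i : 'I_n) : nul (inl i) * ev (f i (i%:Z + 1)) = phi i.
Proof.
have hd := fY_adm_succ i; rewrite /nuletter -mulrA -tofrac1.
by rewrite (iotaE (a := 1)) ?rmorph1 ?mulr1 //; [exact: inK_frac | exact: tofracV_mul].
Qed.

Lemma act_sfun_fY (i : 'I_n) : act (sfun n i) (f i (i%:Z + 1)) = f (i%:Z + 1) i.
Proof. by rewrite act_fY // ?sfunl ?sfunr //; exact: sfun_periodic. Qed.

Lemma nul_int l : intertwines (nul l) (lfun (linv l)).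
Proof.
case: l => [i|b]; last exact: (philetter_int (inr b)).
move=> p; have hd := fY_adm_succ i.
apply: (unitA_mulIr (ev_unit hd)).
rewrite -(mulrA (ev p) (nul (inl i))) nul_phi -(mulrA (nul (inl i))).
by rewrite [ev (act _ _) * _]evCm (mulrA (nul (inl i))) nul_phi (philetter_int (inl i)).
Qed.

Lemma winv_int (g : letter n -> A) (wd : word) :
    (forall l, intertwines (g l) (lfun (linv l))) ->
  intertwines (\prod_(l <- wd) g l) (wfun (winv wd)).
Proof.
move=> hg; elim: wd => [|l wd IH]; first by rewrite big_nil; exact: intertwines1.
rewrite big_cons => p.
rewrite (@act_ext _ _ _ _ (wfun (winv wd) \o lfun (linv l))); last exact: winv_consE.
by apply: intertwines_comp => //; exact: wfun_periodic.
Qed.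

Lemma act_winv_cons l (wd : word) p :
  act (wfun (winv (l :: wd))) p = act (wfun (winv wd)) (act (lfun (linv l)) p).
Proof.
by rewrite act_comp //; [apply: act_ext; exact: winv_consE | exact: wfun_periodic].
Qed.

Lemma nuword_int wd : intertwines (nuw wd) (wfun (winv wd)).
Proof. exact: winv_int nul_int. Qed.

Lemma phiword_int wd : intertwines (phiword wd) (wfun (winv wd)).
Proof. exact: winv_int philetter_int. Qed.

Lemma phi_sq (i : 'I_n) : phi i * phi i = ev (f i (i%:Z + 1) * f (i%:Z + 1) i).
Proof.
have key a b a' b' : T i * ((T i * ev a + ev b) * ev a') + (T i * ev a + ev b) * ev b' =
    T i * ev (c *: (a * a') + b * a' + a * b') + ev (a * a' + b * b').
  rewrite !mulrDl mulrDr -!(mulrA (T i)) (mulrA (T i) (T i)) T_quad mulrDl mul1r.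
  rewrite !(rmorphD ev) (evZ c) !(rmorphM ev) /= !mulrDr -scalerAl -scalerAr -!addrA.
  by congr (_ + _); rewrite addrCA; congr (_ + _); rewrite addrCA.
(* Only the left factor is expanded at first; its coefficients move across the right one, which is
   expanded afterwards. *)
rewrite {1}phiE mulrDl -(mulrA (T i)) !(philetter_int (inl i)) /=.
rewrite actB (actZ _ _ c) !actY ?sfunl ?sfunr //; try exact: sfun_periodic.
rewrite phiE key /fY; move: (Y i) (Y _) => y y'.
(* The coefficient of T_i cancels. *)
rewrite (_ : _ + _ + _ = 0) ?rmorph0 ?mulr0 ?add0r.
  congr (ev _); rewrite -!mul_mpolyC ?mpolyCB.
  have e : t%:MP_[n] * (t^-1)%:MP = 1 by rewrite -mpolyCM divff ?mpolyC1.
  ring: e.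
by rewrite -!mul_mpolyC ?mpolyCB; ring.
Qed.

End Intertwiners.

(** * Normal ordering: leading terms and independence of the word *)

Lemma exists_max_seq (X : eqType) (L : X -> nat) (s : seq X) : s != [::] ->
  exists2 y, y \in s & forall z, z \in s -> (L z <= L y)%N.
Proof.
elim: s => // x s IH _; have [->|/IH[y ys ymax]] := eqVneq s [::].
  by exists x; rewrite ?mem_head // => z; rewrite inE => /eqP->.
have [lxy|lyx] := leqP (L x) (L y).
  exists y; first by rewrite inE ys orbT.
  by move=> z; rewrite inE => /orP[/eqP->//|]; exact: ymax.
exists x; first exact: mem_head.
by move=> z; rewrite inE => /orP[/eqP->//|/ymax/leq_trans]; apply; exact: ltnW.
Qed.

Section NormalOrdering.
Variables (K : fieldType) (n : nat) (t : K).
Hypothesis n_gt1 : (1 < n)%N.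
Hypothesis t_neq0 : t != 0.
Hypothesis t_nroot : forall m : nat, (0 < m)%N -> t ^+ m != 1.
Local Notation P := {mpoly K[n]}.
Local Notation F := {fraction P}.
Local Notation Y i := (Yext n t i).
Local Notation f := (fY n t).
Local Notation word := (seq (letter n)).
Local Notation inK := (@inKY K n t).
Local Notation act := (@act K n t).
Local Notation c := (t - t^-1).

Variables (A : algType K) (T : 'I_n -> A) (pi piinv : A).
Variables (ev : {rmorphism P -> A}) (iota : F -> A) (Tw : seq int -> A).
Hypothesis hrel : daha_relations t T pi piinv ev.
Hypothesis hiota : iota_spec t ev iota.
Hypothesis hTw : Tw_spec T pi piinv Tw.
Hypothesis huniq : unique_normal_ordering t iota Tw.

Local Notation nul := (nuletter t T pi piinv ev iota).
Local Notation nuw := (nuword t T pi piinv ev iota).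
Local Notation Tword := (Tword T pi piinv).
Local Notation phi := (phi t T ev).
Local Notation philetter := (philetter t T pi piinv ev).
Local Notation phiword := (phiword t T pi piinv ev).

Local Notation iota_mul := (iota_mul n_gt1 t_neq0 hrel hiota).
Local Notation iota_add := (iota_add n_gt1 t_neq0 hrel hiota).
Local Notation iotaE := (iotaE n_gt1 t_neq0 hrel hiota).
Local Notation iota_poly := (iota_poly n_gt1 t_neq0 hrel hiota).
Local Notation ev_unit := (ev_unit hrel hiota).
Local Notation evC := (evC hrel).
Local Notation T_quad := (T_quad t_neq0 hrel).
Local Notation phiE := (phiE n_gt1 t_neq0 hrel).
Local Notation phi_sq := (phi_sq n_gt1 t_neq0 hrel).
Local Notation nul_phi := (nul_phi n_gt1 t_neq0 hrel hiota).
Local Notation philetter_int := (philetter_int n_gt1 t_neq0 hrel).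
Local Notation nuword_int := (nuword_int n_gt1 t_neq0 hrel hiota).
Local Notation Y_T := (Y_T n_gt1 t_neq0 hrel).
Local Notation fY_adm_succ := (fY_adm_succ t n_gt1).
Local Notation fY_adm_pred := (fY_adm_pred t n_gt1).
Local Notation inK_frac := (inK_frac n_gt1 t_neq0).
Local Notation tofracV_mul := (tofracV_mul n_gt1 t_neq0).

Lemma Tword_ext (w1 w2 : word) : reduced w1 -> reduced w2 -> wfun w1 =1 wfun w2 ->
  Tword w1 = Tword w2.
Proof. by move=> r1 r2 /(wvalP n_gt1) e; rewrite -!hTw // e. Qed.

Lemma Tword_cons l (wd : word) : Tword (l :: wd) = Tletter T pi piinv l * Tword wd.
Proof. exact: big_cons. Qed.

Lemma nuw_cons l (wd : word) : nuw (l :: wd) = nul l * nuw wd.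
Proof. exact: big_cons. Qed.

Lemma nuw_cat (w1 w2 : word) : nuw (w1 ++ w2) = nuw w1 * nuw w2.
Proof. exact: big_cat. Qed.

Lemma phiword_cons l (wd : word) : phiword (l :: wd) = philetter l * phiword wd.
Proof. exact: big_cons. Qed.

Lemma phiword1 l : phiword [:: l] = philetter l.
Proof. exact: big_seq1. Qed.

Lemma phiword_cat (w1 w2 : word) : phiword (w1 ++ w2) = phiword w1 * phiword w2.
Proof. exact: big_cat. Qed.

(** Multiplying by f_(i,i+1) f_(i+1,i) turns the left side into phi_i^2. *)
Lemma nul_sq (i : 'I_n) : nul (inl i) * nul (inl i) = 1.
Proof.
set nu := nul (inl i).
have e1 : nu * ev (f i (i%:Z + 1)) = phi i by exact: nul_phi.
have e2 : ev (f i (i%:Z + 1)) * phi i = phi i * ev (f (i%:Z + 1) i).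
  by rewrite (philetter_int (inl i)) /= act_sfun_fY.
have u1 := ev_unit (fY_adm_succ i).
have u2 := ev_unit (fY_adm_pred i).
apply: (unitA_mulIr (unitA_mul u1 u2)).
rewrite mul1r mulrA -(mulrA nu) e1 -mulrA -e2 mulrA e1.
by rewrite phi_sq // rmorphM.
Qed.

Lemma ev_act_fY (wd : word) i : act (wfun (winv wd)) (f i (i + 1)) =
  f (wfun (winv wd) i) (wfun (winv wd) (i + 1)).
Proof. by rewrite act_fY //; exact: wfun_periodic. Qed.

(** Every denominator is carried to the right end of the word, where it becomes the f of its
    root. *)
Lemma nuw_phiw (wd : word) : nuw wd * ev (\prod_(p <- wroots wd) f p.1 p.2) = phiword wd.
Proof.
elim: wd => [|[i|b] wd IH]; first by rewrite /nuword /phiword !big_nil rmorph1 mulr1.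
  rewrite nuw_cons phiword_cons -IH /= big_cons /= rmorphM.
  rewrite -(mulrA (nul (inl i))) (mulrA (nuw wd)) -ev_act_fY.
  rewrite -nuword_int -(mulrA _ (nuw wd)).
  by rewrite (mulrA (nul (inl i))) nul_phi.
by rewrite nuw_cons phiword_cons -IH /= -mulrA.
Qed.

(** The product collapses from the middle outwards: phi_i p phi_i = phi_i^2 s_i(p) is again a
    polynomial. *)
Lemma phiw_winv (wd : word) : exists p, phiword wd * phiword (winv wd) = ev p.
Proof.
have [_ [_ [[p1 p2] _]]] := hrel.
elim: wd => [|l wd [p IH]]; first by exists 1; rewrite /phiword !big_nil rmorph1 mulr1.
rewrite winv_cons phiword_cat (phiword_cons _ wd) -mulrA (mulrA (phiword wd)) IH.
rewrite phiword1 (philetter_int (linv l)) mulrA linvK.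
case: l => [i|b] /=.
  by rewrite phi_sq // -rmorphM; eexists; reflexivity.
by case: b; rewrite ?p1 ?p2 mul1r; eexists; reflexivity.
Qed.

(** The outermost pair collapses last, so its factor f_(i+1,i) is not transported by any other
    letter. *)
Lemma phiw_winv_inl i (wd : word) : exists p,
  phiword (inl i :: wd) * phiword (winv (inl i :: wd)) =
  ev (p * f (i%:Z + 1) i).
Proof.
have [p IH] := phiw_winv wd.
rewrite winv_cons phiword_cat (phiword_cons _ wd) -mulrA (mulrA (phiword wd)) IH.
rewrite phiword1 (philetter_int (inl i)) mulrA /=.
rewrite phi_sq // -rmorphM; exists (act (sfun n i) p * f i (i%:Z + 1)).
by congr (ev _); ring.
Qed.

(** * Spans of the T_w with restricted words and coefficients *)

Section Span.
Variables (Pw : word -> Prop) (Rg : F -> Prop).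

(** Formal sums in which a word may occur repeatedly, so that addition is concatenation;
    [span_normal] collects equal terms. *)
Inductive Tspan : A -> Prop :=
| span0 : Tspan 0
| spanS wd g h : Pw wd -> Rg g -> Tspan h -> Tspan (Tword wd * iota g + h).

Lemma span_term wd g : Pw wd -> Rg g -> Tspan (Tword wd * iota g).
Proof. by move=> hw hg; rewrite -[X in Tspan X]addr0; apply: spanS => //; exact: span0. Qed.

Lemma spanD h1 h2 : Tspan h1 -> Tspan h2 -> Tspan (h1 + h2).
Proof.
elim=> [|wd g h pw rg _ IH] s2; first by rewrite add0r.
by rewrite -addrA; apply: spanS => //; exact: IH.
Qed.

End Span.

Lemma span_sub (Pw Pw' : word -> Prop) (Rg : F -> Prop) h : (forall wd, Pw wd -> Pw' wd) ->
  Tspan Pw Rg h -> Tspan Pw' Rg h.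
Proof. by move=> sub; elim=> [|wd g h' /sub pw rg _]; [exact: span0 | exact: spanS]. Qed.

(** What normal ordering asks of a class of coefficients. It is applied to all of K[~Y] and to its
    elements regular at the point, so that one argument serves both leading terms and regularity. *)
Definition coeffs (Rg : F -> Prop) :=
  [/\ forall g, Rg g -> inK g, forall g h, Rg g -> Rg h -> Rg (g + h),
      forall g h, Rg g -> Rg h -> Rg (g * h) & forall p : P, Rg p%:F].

Lemma coeffs_inK : coeffs inK.
Proof. by split=> // *; [exact: inKD | exact: inKM | exact: inK_poly]. Qed.

Lemma coeffs_inKreg : coeffs (@inKreg K n t).
Proof.
split=> [g []//|g h|g h|p]; first exact: inKregD.
  exact: inKregM.
exact: inKreg_poly.
Qed.

Definition below (k : nat) (wd : word) := reduced wd /\ (scount wd < k)%N.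

Section SpanModule.
Variable Rg : F -> Prop.
Hypothesis hR : coeffs Rg.

Lemma span_mulr Pw h g : Tspan Pw Rg h -> Rg g -> Tspan Pw Rg (h * iota g).
Proof.
case: hR => RK _ RM _; elim=> [|wd g' h' pw rg _ IH] hg; first by rewrite mul0r; exact: span0.
rewrite mulrDl -mulrA -iota_mul; try exact: RK.
by apply: spanS => //; [exact: RM | exact: IH].
Qed.

Lemma span_ev Pw h p : Tspan Pw Rg h -> Tspan Pw Rg (h * ev p).
Proof.
move=> sh; rewrite -iota_poly.
by apply: span_mulr sh _; case: hR.
Qed.

Lemma span_opp Pw h : Tspan Pw Rg h -> Tspan Pw Rg (- h).
Proof. by move=> /(span_ev (-1)); rewrite rmorphN rmorph1 mulrN1. Qed.

(** At an ascent T_i T_w = T_(s_i w). At a descent w = s_i v, and the quadratic relation gives T_i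
    T_w = (t - t^-1) T_w + T_v. *)
Lemma span_T k i h : Tspan (below k) Rg h -> Tspan (below k.+1) Rg (T i * h).
Proof.
case: hR => RK _ RM RP.
elim=> [|wd g h' [rw lw] rg _ IH]; first by rewrite mulr0; exact: span0.
rewrite mulrDr mulrA; apply: spanD => // {IH}.
case: (boolP (iasc wd i)) => asc.
  rewrite -[T i * _]/(Tletter T pi piinv (inl i) * _) -Tword_cons.
  apply: span_term => //; split; last by rewrite scount_cons.
  exact/(reduced_inl n_gt1).
have [wr [rr er]] := reduced_desc n_gt1 rw asc.
have sc := reduced_scount n_gt1 rr rw er; rewrite scount_cons in sc.
rewrite -(Tword_ext rr rw er) Tword_cons /= mulrA T_quad mulrDl mul1r.
rewrite mulrDl -scalerAl -scalerAl scalerAr -[T i * _]/(Tletter T pi piinv (inl i) * _) -Tword_cons.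
have -> : c *: iota g = iota ((c%:MP)%:F * g).
  rewrite iota_mul; [|exact: inK_poly|exact: RK].
  by rewrite iota_poly evC mulr_algl.
apply: spanD; apply: span_term => //; last 1 first.
- by split; [exact: reduced_cons rr | lia].
- by split=> //; rewrite scount_cons; lia.
- exact: RM.
Qed.

Lemma span_inr k b h : Tspan (below k) Rg h ->
  Tspan (below k) Rg (Tletter T pi piinv (inr b) * h).
Proof.
elim=> [|wd g h' [rw lw] rg _ IH]; first by rewrite mulr0; exact: span0.
rewrite mulrDr mulrA -Tword_cons; apply: spanS => //.
by split; [exact/(reduced_inr n_gt1) | rewrite scount_cons].
Qed.

Lemma ev_T (i : 'I_n) p : exists e, ev p * T i = T i * ev (act (sfun n i) p) + ev e.
Proof.
elim/mpoly_ind_gen: p => [k|k|p r [e IHp] [e' IHr]|p r [e IHp] [e' IHr]].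
- by exists 0; rewrite actC evC rmorph0 addr0 -scalerAl mul1r -scalerAr mulr1.
- rewrite actX -(Yext0 t n_gt1); exact: Y_T.
- exists (e + e'); rewrite actD !rmorphD /= mulrDl IHp IHr mulrDr.
  by rewrite -!addrA; congr (_ + _); rewrite addrCA.
- exists (e * act (sfun n i) r + p * e'); rewrite actM !(rmorphM ev) (rmorphD ev) /=.
  rewrite -mulrA IHr mulrDr mulrA IHp mulrDl !(rmorphM ev) mulrA.
  by rewrite -addrA.
Qed.

(** Moving a polynomial past T_i leaves a polynomial correction in which that letter is lost, hence
    the triangularity; no denominator arises. *)
Lemma ev_Tword (wd : word) p : reduced wd -> exists h, Tspan (below (scount wd)) Rg h /\
  ev p * Tword wd = Tword wd * ev (act (wfun (winv wd)) p) + h.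
Proof.
have [_ [_ [[p1 p2] _]]] := hrel.
elim: wd p => [|[i|b] wd IH] p rd.
- by exists 0; split; [exact: span0 | rewrite /Tword big_nil act_id // mulr1 mul1r addr0].
- have rw := reduced_cons n_gt1 rd.
  have [e he] := ev_T i p.
  have [h1 [s1 e1]] := IH (act (sfun n i) p) rw; have [h2 [s2 e2]] := IH e rw.
  exists (T i * h1 + (Tword wd * ev (act (wfun (winv wd)) e) + h2)); split.
    rewrite scount_cons; apply: spanD; first exact: span_T.
    apply: spanD; last by apply: span_sub s2 => w [? /leqW].
    rewrite -iota_poly; apply: span_term; first by split.
    by case: hR.
  rewrite Tword_cons /= mulrA he mulrDl -mulrA e1 e2 mulrDr !mulrA -addrA.
  by rewrite (act_winv_cons n_gt1 t_neq0 (inl i) wd p).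
- have rw := reduced_cons n_gt1 rd.
  set l : letter n := inr b.
  have hl : ev p * Tletter T pi piinv l = Tletter T pi piinv l * ev (act (lfun (linv l)) p).
    exact: (philetter_int l p).
  have [h1 [s1 e1]] := IH (act (lfun (linv l)) p) rw.
  exists (Tletter T pi piinv l * h1); split; first by rewrite scount_cons; exact: span_inr.
  rewrite Tword_cons mulrA hl -mulrA e1 mulrDr mulrA.
  by rewrite (act_winv_cons n_gt1 t_neq0 l wd p).
Qed.

Lemma span_evl k h p : Tspan (below k) Rg h -> Tspan (below k) Rg (ev p * h).
Proof.
elim=> [|wd g h' [rw lw] rg _ IH]; first by rewrite mulr0; exact: span0.
rewrite mulrDr mulrA; apply: spanD => // {IH}.
have [h1 [s1 ->]] := ev_Tword p rw; rewrite mulrDl; apply: spanD.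
  apply: span_mulr => //; apply: span_ev; rewrite -[Tword wd]mulr1 -(rmorph1 ev).
  rewrite -iota_poly; apply: span_term => //.
  by case: hR.
apply: span_mulr => //; apply: span_sub s1 => w [? lw']; split=> //; exact: ltn_trans lw.
Qed.

Lemma span_normal Pw h : (forall wd, Pw wd -> reduced wd) -> Tspan Pw Rg h ->
  exists s g, normal_ordering t iota Tw h s g /\
    (forall x, x \in s -> (exists2 wd, Pw wd & wval wd = x) /\ Rg (g x)).
Proof.
case: hR => RK RD _ _ hP.
elim=> [|wd g h' pw rg _ [s [G [[us hs ->] hG]]]].
  by exists [::], (fun=> 0); split=> //; split=> //; rewrite big_nil.
set x := wval wd; have hx := hTw (hP _ pw).
(* The new coefficient is added to that of [x] if [x] is already listed. *)
pose G' y := if y == x then (if x \in s then g + G x else g) else G y.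
have eG (r : seq (seq int)) : x \notin r ->
    \sum_(y <- r) Tw y * iota (G' y) = \sum_(y <- r) Tw y * iota (G y).
  move=> nx; rewrite !big_seq; apply: eq_bigr => y yr; rewrite /G'.
  by case: eqP => // e; rewrite -e yr in nx.
case: (boolP (x \in s)) => xs.
  exists s, G'; split; last first.
    move=> y ys; have [[w pw' ew] rG] := hG y ys; split; first by exists w.
    by rewrite /G'; case: eqP => // _; rewrite xs; apply: RD => //; case: (hG x xs).
  split=> //.
    move=> y ys; have [ey iy] := hs y ys; split=> //; apply: RK.
    by rewrite /G'; case: eqP => _; [rewrite xs; apply: RD => //; case: (hG x xs) | case: (hG y ys)].
  have ps := perm_to_rem xs; rewrite !(perm_big _ ps) /= !big_cons eG; last first.
    by rewrite mem_rem_uniq // inE eqxx.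
  rewrite /G' eqxx xs iota_add; [|exact: RK|by case: (hG x xs) => _ /RK].
  by rewrite mulrDr -hx addrA.
exists (x :: s), G'; split.
  split; first by rewrite /= xs us.
    move=> y; rewrite inE /G'; case: eqP => [->|_] /=; last exact: hs.
    by rewrite (negPf xs); split; [exists wd | exact: RK].
  by rewrite big_cons eG // /G' eqxx (negPf xs) -hx.
move=> y; rewrite inE /G'; case: eqP => [->|_] /=; last exact: hG.
by rewrite (negPf xs); split=> //; exists wd.
Qed.

End SpanModule.

(** By uniqueness the given ordering agrees with the one that puts the term of [w0] in front of a
    collected form of [h], in which [w0] does not occur. *)
Lemma normal_lead Pw w0 a h s g :
    reduced w0 -> inK a -> (forall wd, Pw wd -> reduced wd /\ wval wd != wval w0) ->
    Tspan Pw inK h -> normal_ordering t iota Tw (Tword w0 * iota a + h) s g ->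
  nocoef s g (wval w0) = a /\
  forall x, x != wval w0 -> nocoef s g x != 0 -> exists2 wd, Pw wd & wval wd = x.
Proof.
move=> r0 ia hP sh no; have [s2 [g2 [[us hs eh] hg2]]] := span_normal coeffs_inK (fun wd p => (hP wd p).1) sh.
have nx : wval w0 \notin s2.
  by apply/negP => /hg2[[w pw ew] _]; have [_] := hP w pw; rewrite ew eqxx.
pose G y := if y == wval w0 then a else g2 y.
have no' : normal_ordering t iota Tw (Tword w0 * iota a + h) (wval w0 :: s2) G.
  split; first by rewrite /= nx us.
    move=> y; rewrite inE /G; case: eqP => [->|_] /=; last exact: hs.
    by split=> //; exists w0.
  rewrite big_cons {1}/G eqxx hTw // {1}eh; congr (_ + _).
  rewrite !big_seq; apply: eq_bigr => y ys; rewrite /G.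
  by case: eqP => // e; rewrite -e ys in nx.
have U := huniq no no'; split; first by rewrite U /nocoef mem_head /G eqxx.
move=> x nxw; rewrite U /nocoef inE (negPf nxw) /=.
by case: ifP => [xs _|_]; [case: (hg2 x xs) | rewrite eqxx].
Qed.

(** At j = i + 1 this is the coefficient of T_i in nu_i; at a root it is that coefficient carried to
    the right end of the word. *)
Definition nuratio (i j : int) : F := (Y i - Y j)%:F / (f i j)%:F.
Definition leadcoef (wd : word) : F := \prod_(p <- wroots wd) nuratio p.1 p.2.

Lemma nuratio_shift i j : nuratio (i + n%:Z) (j + n%:Z) = nuratio i j.
Proof.
have e k : k + n%:Z = k + 1 * n%:Z by rewrite mul1r.
have nq : (qq t) ^ (- (1 : int)) != 0 by rewrite expfz_neq0 // qq_neq0.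
rewrite /nuratio !e fY_shift // !Yext_shift // -scalerBr -!mul_mpolyC !tofracM.
by rewrite -mulf_div divff ?mul1r // tofrac_eq0 mpolyC_eq0.
Qed.

Lemma adm_root (wd : word) (i : int) :
  adm t (f (wfun (winv wd) i) (wfun (winv wd) (i + 1))).
Proof.
apply: adm_fY; apply: periodic_mod; [exact: n_gt1|exact: wfun_periodic|exact: wfunK|].
exact: succ_mod_neq.
Qed.

Lemma inK_leadcoef wd : inK (leadcoef wd).
Proof.
rewrite /leadcoef; elim: wd => [|[i|b] wd IH] //=; first by rewrite big_nil -tofrac1; exact: inK_poly.
by rewrite big_cons; apply: inKM => //; apply: inK_frac => //; exact: adm_root.
Qed.

(** Only the first letter is expanded, by the normal form of phi_i, and its coefficients are carried
    through [nuw wd]. *)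
Lemma nul_nuw (i : 'I_n) (wd : word) (r := (wfun (winv wd) i, wfun (winv wd) (i%:Z + 1))) :
  nuw (inl i :: wd) = T i * nuw wd * iota (nuratio r.1 r.2) +
     nuw wd * iota ((c *: Y r.2)%:F / (f r.1 r.2)%:F).
Proof.
have hd := adm_root wd i; rewrite /r /=.
set d := f _ _ in hd *.
apply: (unitA_mulIr (ev_unit hd)).
rewrite mulrDl -(mulrA (T i * _)) -(mulrA (nuw wd)).
rewrite !(iotaE (inK_frac _ hd) hd (tofracV_mul _ hd)) //.
rewrite nuw_cons -(mulrA (nul (inl i))) /d -ev_act_fY.
rewrite -nuword_int (mulrA (nul (inl i))) nul_phi //.
rewrite phiE // mulrDl -(mulrA (T i)) !nuword_int mulrA.
have pw := wfun_periodic n_gt1 (winv wd).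
by rewrite actB (actZ _ _ c) !actY.
Qed.

(** In [nul_nuw] only T_i times the previous leading term can reach the new length. *)
Lemma nu_lead (wd : word) : reduced wd -> exists h, Tspan (below (scount wd)) inK h /\
  nuw wd = Tword wd * iota (leadcoef wd) + h.
Proof.
elim: wd => [|[i|b] wd IH] rd.
- exists 0; split; first exact: span0.
  rewrite /nuword /Tword /leadcoef !big_nil -tofrac1 iota_poly.
  by rewrite rmorph1 mulr1 addr0.
- have rw := reduced_cons n_gt1 rd; have [h [sh eh]] := IH rw.
  have hd := adm_root wd i.
  rewrite nul_nuw eh; set r1 := nuratio _ _; set r2 := _ / _.
  have i1 : inK r1 by exact: inK_frac.
  have i2 : inK r2 by exact: inK_frac.
  exists (T i * h * iota r1 + (Tword wd * iota (leadcoef wd) + h) * iota r2); split.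
    rewrite scount_cons; apply: spanD; apply: (span_mulr coeffs_inK) => //.
      exact: (span_T coeffs_inK).
    apply: spanD; last by apply: span_sub sh => w [? /leqW].
    by apply: span_term; [split | exact: inK_leadcoef].
  rewrite addrA mulrDr mulrDl Tword_cons /leadcoef /= big_cons -/(leadcoef wd) /=.
  by rewrite (mulrC _ (leadcoef wd)) (iota_mul (inK_leadcoef wd) i1) !mulrA.
- have rw := reduced_cons n_gt1 rd; have [h [sh eh]] := IH rw.
  exists (Tletter T pi piinv (inr b) * h); split; first by rewrite scount_cons; exact: span_inr.
  by rewrite nuw_cons eh Tword_cons mulrDr mulrA.
Qed.

Lemma leadcoef_invprod (wd : word) : reduced wd ->
  leadcoef wd = invprod n *%R nuratio (wfun wd).
Proof. by move=> rd; apply: roots_invprod => // i j; exact: nuratio_shift. Qed.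

(* The leading term T_y of an intertwiner for x satisfies y^-1 j = x^-1 j for all j, *)
(* because the Y_j are pairwise distinct.                                            *)
Lemma lower_intertwiner0 (wd : word) d : reduced wd -> Tspan (below (scount wd)) inK d ->
  intertwines t ev d (wfun (winv wd)) -> d = 0.
Proof.
move=> rd sd dint.
have [s [g [[us hs ed] hg]]] := span_normal coeffs_inK (fun w (p : below _ w) => p.1) sd.
(* Zero coefficients are dropped so that the term of maximal length is really present. *)
pose s1 := [seq x <- s | g x != 0].
have ed1 : d = \sum_(x <- s1) Tw x * iota (g x).
  rewrite ed big_filter [RHS]big_mkcond /=; apply: eq_bigr => x _.
  case: eqP => //= ->; rewrite -tofrac0 iota_poly rmorph0.
  by rewrite mulr0.
have [e0|/(exists_max_seq (fun x => ilen n (wext n x)))[y ys ymax]] := eqVneq s1 [::].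
  by rewrite ed1 e0 big_nil.
exfalso; move: ys; rewrite mem_filter => /andP[gy ys].
have [[w0 [r0 l0] e0] iy] := hg y ys.
have len (w : word) : reduced w -> ilen n (wext n (wval w)) = scount w.
  by move=> /(reducedE n_gt1) ->; apply: invprod_ext => j; exact: wext_wval.
pose Pw (w : word) := reduced w /\ wval w != wval w0.
(* Compares the coefficients of T_y on both sides of Y_j d = d z, where [z] is Y_(x^-1 j) for the
   element x of [wd]. *)
have key j : wfun (winv w0) j = wfun (winv wd) j.
  have [h0 [sh0 eh0]] := ev_Tword coeffs_inK (Y j) r0.
  rewrite actY // in eh0; last exact: wfun_periodic.
  have low k h : (k <= scount w0)%N -> Tspan (below k) inK h -> Tspan Pw inK h.
    move=> lk; apply: span_sub => w [rw lw]; split=> //.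
    apply: contraTneq lw => e; rewrite -leqNgt (leq_trans lk) //.
    by rewrite (reduced_scount n_gt1 r0 rw) //; apply/(wvalP n_gt1).
  set z := Y (wfun (winv wd) j).
  (* The other terms of [d] contribute only elements different from [y]: they are no longer than
     [y], and their corrections are shorter. *)
  have rest r : {subset r <= s1} -> y \notin r -> exists2 H, Tspan Pw inK H &
     ev (Y j) * (\sum_(x <- r) Tw x * iota (g x)) - (\sum_(x <- r) Tw x * iota (g x)) * ev z = H.
    elim: r => [|x r IH] sub yr.
      by exists 0; [exact: span0 | rewrite big_nil mulr0 mul0r subr0].
    have sub' : {subset r <= s1} by move=> v vr; apply: sub; rewrite inE vr orbT.
    have yr' : y \notin r by move: yr; rewrite inE negb_or => /andP[].
    have [H sH eH] := IH sub' yr'.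
    have xs1 : x \in s1 by apply: sub; exact: mem_head.
    have := xs1; rewrite mem_filter => /andP[gx xs].
    have [[w1 [r1 l1] e1] ix] := hg x xs.
    have [h1 [sh1 eh1]] := ev_Tword coeffs_inK (Y j) r1.
    have sc1 : (scount w1 <= scount w0)%N by rewrite -!len // e1 e0; exact: ymax.
    have P1 : Pw w1.
      split=> //; rewrite e1 e0; apply: contra yr => /eqP->; exact: mem_head.
    eexists; last by [].
    rewrite big_cons mulrDr mulrDl opprD addrACA eH; apply: spanD => //.
    rewrite -e1 in ix *; rewrite hTw // mulrA eh1 mulrDl; apply: spanD.
      apply: spanD; apply: (span_mulr coeffs_inK) => //; last exact: low sc1 sh1.
      apply: (span_ev coeffs_inK); rewrite -[Tword w1]mulr1 -(rmorph1 ev).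
      rewrite -iota_poly; apply: span_term => //.
      exact: inK_poly.
    apply: (span_opp coeffs_inK); apply: (span_ev coeffs_inK).
    by apply: span_term => //; rewrite e1.
  have us1 : uniq s1 by exact: filter_uniq.
  have ys1 : y \in s1 by rewrite mem_filter gy.
  have nyr : y \notin rem y s1 by rewrite mem_rem_uniq // inE eqxx.
  have [H sH eH] := rest (rem y s1) (@mem_rem _ y s1) nyr.
  have ed2 : d = Tword w0 * iota (g y) + \sum_(x <- rem y s1) Tw x * iota (g x).
    by rewrite ed1 (perm_big _ (perm_to_rem ys1)) big_cons -e0 hTw.
  set a := ((Y (wfun (winv w0) j) - z)%:F * g y).
  have ia : inK a by apply: inKM => //; exact: inK_poly.
  have zero : Tword w0 * iota a + (h0 * iota (g y) + H) = 0.
    have := dint (Y j); rewrite actY //; last exact: wfun_periodic.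
    move/eqP; rewrite -subr_eq0 -/z => /eqP <-; rewrite ed2 mulrDr mulrDl opprD addrACA eH.
    rewrite addrA; congr (_ + _); rewrite mulrA eh0 mulrDl addrAC; congr (_ + _).
    rewrite iota_mul //; last exact: inK_poly.
    rewrite iota_poly rmorphB /= mulrBl mulrBr !mulrA.
    congr (_ - _); rewrite -!mulrA; congr (_ * _).
    rewrite -!iota_poly -!iota_mul ?(mulrC z%:F) //; exact: inK_poly.
  have hP w : Pw w -> reduced w /\ wval w != wval w0 by [].
  have sH' : Tspan Pw inK (h0 * iota (g y) + H).
    apply: spanD => //; apply: (span_mulr coeffs_inK) => //; exact: low (leqnn _) sh0.
  (* The element is zero and so has the empty normal ordering; by uniqueness [a] vanishes. *)
  have no0 : normal_ordering t iota Tw (Tword w0 * iota a + (h0 * iota (g y) + H)) [::] (fun=> 0).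
    by rewrite zero; split=> //; rewrite big_nil.
  have [/esym/eqP] := normal_lead r0 ia hP sH' no0.
  rewrite /nocoef /= mulf_eq0 (negPf gy) orbF tofrac_eq0 subr_eq0 => /eqP /(Yext_inj n_gt1 t_neq0 t_nroot) -> //.
(* So [y] is the element of [wd], against the length bound on [d]. *)
have := l0; rewrite -(reduced_scount n_gt1 r0 rd) ?ltnn // => j.
by have := winv_ext n_gt1 key j; rewrite !winvK.
Qed.

Lemma nuw_reduced_ext (w1 w2 : word) : reduced w1 -> reduced w2 -> wfun w1 =1 wfun w2 ->
  nuw w1 = nuw w2.
Proof.
move=> r1 r2 e; have [h1 [s1 e1]] := nu_lead r1; have [h2 [s2 e2]] := nu_lead r2.
apply/eqP; rewrite -subr_eq0; apply/eqP/(lower_intertwiner0 r1).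
  have -> : nuw w1 - nuw w2 = h1 - h2.
    rewrite e1 e2 (Tword_ext r1 r2 e) !leadcoef_invprod //.
    rewrite (_ : invprod n *%R nuratio (wfun w1) = invprod n *%R nuratio (wfun w2)).
      by rewrite opprD addrACA subrr add0r.
    exact: invprod_ext.
  apply: spanD => //; apply: (span_opp coeffs_inK).
  by rewrite (reduced_scount n_gt1 r1 r2 e).
move=> p; rewrite mulrBr mulrBl nuword_int.
by rewrite (nuword_int w2) (act_ext t p (winv_ext n_gt1 e)).
Qed.

(** Letters are absorbed from the right; one that shortens the element cancels by nu_i^2 = 1. *)
Lemma nuw_to_reduced (w wr : word) : reduced wr -> wfun w =1 wfun wr -> nuw w = nuw wr.
Proof.
elim: w wr => [|l w IH] wr rr e; first by apply: nuw_reduced_ext => //; exact: reduced_nil.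
have [v [rv ev']] := exists_reduced n_gt1 w.
rewrite nuw_cons (IH v rv) => [|j]; last by rewrite ev'.
have elv : wfun (l :: v) =1 wfun wr by move=> j; rewrite -e /= ev'.
case: l {IH} e elv => [i|b] e elv; last first.
  by rewrite -nuw_cons; apply: nuw_reduced_ext => //; exact/(reduced_inr n_gt1).
case: (boolP (iasc v i)) => asc.
  by rewrite -nuw_cons; apply: nuw_reduced_ext => //; exact/(reduced_inl n_gt1).
have [u [ru eu]] := reduced_desc n_gt1 rv asc.
rewrite (nuw_reduced_ext rv ru) => [|j]; last by rewrite eu.
rewrite nuw_cons mulrA nul_sq mul1r; apply: nuw_reduced_ext => //.
  exact: reduced_cons ru.
by move=> j; rewrite -elv /= -eu /= sfunK.
Qed.

Lemma nuw_ext (w1 w2 : word) : wfun w1 =1 wfun w2 -> nuw w1 = nuw w2.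
Proof.
move=> e; have [v [rv ev']] := exists_reduced n_gt1 w2.
rewrite (nuw_to_reduced rv (w := w2)) => [|j]; last by rewrite ev'.
by apply: nuw_to_reduced => // j; rewrite e ev'.
Qed.

End NormalOrdering.

(** * A word for the reflection exchanging a and a + n + 1, and its roots *)

Section ReflectionWord.
Variable n : nat.
Hypothesis n_gt1 : (1 < n)%N.
Local Notation word := (seq (letter n)).
Local Notation expo := (expo n).

(** Runs of letters starting at a pass n, so letters are indexed by natural numbers reduced mod n,
    while permutations are computed with the number itself. *)
Definition ordz (k : nat) : 'I_n := Ordinal (ltn_pmod k (ltnW n_gt1)).

Lemma ordzE k : (ordz k)%:Z = k%:Z + (- (k %/ n)%N%:Z) * n%:Z.
Proof. by have /= := divn_eq k n; lia. Qed.

Lemma sfun_ordz k : sfun n (ordz k)%:Z =1 sfun n k%:Z.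
Proof. by move=> j; rewrite ordzE sfun_shift. Qed.

Lemma expo_shift i m : expo (i + m * n%:Z) = expo i + m.
Proof.
have [r [k ->]] := ixP n_gt1 i.
have -> : ix r k + m * n%:Z = ix r (k + m) by rewrite /ix; ring.
by rewrite !expo_ix //; ring.
Qed.

Lemma expo_small (i : nat) : (i < n)%N -> expo (i%:Z + 1) = - i%:Z.
Proof. by move=> li; have := expo_ix n_gt1 (Ordinal li) 0; rewrite /ix mul0r addr0 sub0r. Qed.

Lemma expo_medium (i : nat) : (n <= i < n + n)%N -> expo (i%:Z + 1) = 1 - (i - n)%N%:Z.
Proof.
move=> /andP[ni li]; rewrite (_ : i%:Z + 1 = (i - n)%N%:Z + 1 + 1 * n%:Z); last by lia.
by rewrite expo_shift expo_small; lia.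
Qed.

Variable a : nat.
Hypotheses (a_gt0 : (0 < a)%N) (a_ltn : (a < n)%N).

(** The offsets [m] fill one period; the third case is the wrap-around, where s_(a+n-1) is s_(a-1)
    and moves a to a - 1. *)
Lemma sfun_near k m : (k < n)%N -> (m < n)%N ->
  sfun n (a + k)%N%:Z (a%:Z + m%:Z) =
    if m == k then a%:Z + m%:Z + 1 else if m == k.+1 then a%:Z + m%:Z - 1
    else if (m == 0) && (k.+1 == n) then a%:Z - 1 else a%:Z + m%:Z.
Proof.
move=> lk lm; case: (leqP k m) => lkm.
  have -> : a%:Z + m%:Z = (a + k)%N%:Z + (m - k)%N%:Z + 0 * n%:Z by lia.
  rewrite sfun_rep //; last by lia.
  by rewrite /flip01; do ?[case: ifP => ?]; lia.
have -> : a%:Z + m%:Z = (a + k)%N%:Z + (n + m - k)%N%:Z + (- 1) * n%:Z by lia.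
rewrite sfun_rep //; last by lia.
by rewrite /flip01; do ?[case: ifP => ?]; lia.
Qed.

Definition run (k d : nat) : word := [seq inl (ordz (a + j)) | j <- iota k d].

Lemma runS k d : run k d.+1 = inl (ordz (a + k)) :: run k.+1 d.
Proof. by []. Qed.

Lemma run_rcons k d : run k d.+1 = run k d ++ [:: inl (ordz (a + (k + d)))].
Proof. by rewrite /run -addn1 iotaD map_cat. Qed.

Lemma wfun_run k m : (k < n)%N -> (m < n)%N ->
  wfun (run 0 k) (a%:Z + m%:Z) =
    if (m < k)%N then a%:Z + m%:Z + 1 else if m == k then a%:Z else a%:Z + m%:Z.
Proof.
elim: k m => [|k IH] m lk lm; first by rewrite /=; case: eqP => [->|_]; rewrite ?addr0.
rewrite run_rcons wfun_cat /= sfun_ordz sfun_near //; last exact: ltnW.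
have -> : (k.+1 == n) = false by lia.
rewrite andbF; case: eqP => [->|nmk].
  rewrite (_ : a%:Z + k%:Z + 1 = a%:Z + k.+1%:Z); last by lia.
  by rewrite IH ?(ltnW lk) //; do ?[case: ifP => ?]; lia.
case: eqP => [emk|nmk'].
  rewrite (_ : a%:Z + m%:Z - 1 = a%:Z + k%:Z); last by lia.
  by rewrite IH ?(ltnW lk) //; do ?[case: ifP => ?]; lia.
by rewrite IH ?(ltnW lk) //; do ?[case: ifP => ?]; lia.
Qed.

Lemma wfun_run_end : wfun (run 0 n.-1) (a%:Z + n%:Z) = a%:Z + n%:Z + 1.
Proof.
rewrite wfun_periodic // -[X in wfun _ X]addr0 -[0]/(0%N%:Z) wfun_run; try lia.
by case: ifP; lia.
Qed.

(** s_(a+k) acts first and each later letter carries the point one further, up to a + n; for k > 0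
    only the last letter, which is s_(a-1), moves a. *)
Lemma winv_run k d m : (k + d)%N = n -> (0 < d)%N -> (m <= k)%N ->
  wfun (winv (run k d)) (a%:Z + m%:Z) =
    if m == k then a%:Z + n%:Z else if m == 0 then a%:Z - 1 else a%:Z + m%:Z.
Proof.
elim: d k m => // d IH k m ekd _ lmk.
rewrite runS winv_consE /= sfun_ordz sfun_near //; try lia.
case: (posnP d) => [d0|dpos].
  rewrite d0 /=; do ?[case: ifP => ?]; lia.
case: eqP => [->|nmk].
  rewrite (_ : a%:Z + k%:Z + 1 = a%:Z + k.+1%:Z); last by lia.
  by rewrite IH ?eqxx //; lia.
have -> : (m == k.+1) = false by lia.
have -> : (m == 0) && (k.+1 == n) = false by lia.
by rewrite IH //; [case: eqP => //; lia | lia | lia].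
Qed.

(* Says that f_ij does not vanish at the point. *)
Definition noncritical (p : int * int) := expo p.1 + 1 != expo p.2.

Lemma noncritical_shift i j m :
  noncritical (i + m * n%:Z, j + m * n%:Z) = noncritical (i, j).
Proof. by rewrite /noncritical /= !expo_shift addrAC (inj_eq (addIr _)). Qed.

Lemma root_shift (wd : word) k :
  noncritical (wfun wd (ordz k)%:Z, wfun wd ((ordz k)%:Z + 1)) =
  noncritical (wfun wd k%:Z, wfun wd (k%:Z + 1)).
Proof.
rewrite ordzE addrAC !(periodicM _ _ (wfun_periodic n_gt1 wd)).
exact: noncritical_shift.
Qed.

Lemma expo_a : expo a%:Z = 1 - a%:Z.
Proof. by rewrite (_ : a%:Z = a.-1%:Z + 1) ?expo_small; lia. Qed.

Lemma expo_an : expo (a%:Z + n%:Z + 1) = 1 - a%:Z.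
Proof. by rewrite -PoszD expo_medium ?addnK //; lia. Qed.

Lemma noncritical_a_an : noncritical (a%:Z, a%:Z + n%:Z + 1).
Proof. by rewrite /noncritical /= expo_a expo_an; lia. Qed.

(** The roots are (a, a + j) with 0 < j <= k; only j = n would be critical. *)
Lemma wroots_descending k : (k < n)%N -> all noncritical (wroots (winv (run 0 k))).
Proof.
elim: k => // k IH lk; rewrite run_rcons winv_cat /= IH ?(ltnW lk) // andbT winvK add0n.
rewrite root_shift PoszD wfun_run ?ltnn ?eqxx ?(ltnW lk) //.
rewrite (_ : a%:Z + k%:Z + 1 = a%:Z + k.+1%:Z); last by lia.
rewrite wfun_run ?(ltnW lk) //.
have -> : (k.+1 < k)%N = false by lia.
have -> : (k.+1 == k) = false by lia.
rewrite /noncritical /= expo_a (_ : a%:Z + k.+1%:Z = (a + k)%N%:Z + 1); last by lia.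
by have [lak|lak] := ltnP (a + k)%N n; [rewrite expo_small | rewrite expo_medium]; lia.
Qed.

Definition descent : word := winv (run 0 n.-1).

Lemma winv_run_descent k d i : wfun (winv (run k d ++ descent)) i =
  wfun (run 0 n.-1) (wfun (winv (run k d)) i).
Proof. by rewrite winv_cat wfun_cat /descent winvK. Qed.

(** The roots of the run are (a + j + 1, a + n + 1) for k <= j < n - 1, and (a, a + n + 1). The
    letter j = 0, excluded by [0 < k], has the critical root (a - n, a + n + 1). *)
Lemma wroots_ascending k d : (0 < k)%N -> (k + d)%N = n ->
  all noncritical (wroots (run k d ++ descent)).
Proof.
elim: d k => [|d IH] k k0 ekd; first by apply: wroots_descending; lia.
rewrite runS /= IH //; last by lia.
rewrite andbT root_shift !winv_run_descent PoszD.
case: (posnP d) => [d0|dpos].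
  rewrite d0 /= (_ : k = n.-1); last by lia.
  rewrite wfun_run ?ltnn ?eqxx; try lia.
  rewrite (_ : _ + n.-1%:Z + 1 = a%:Z + n%:Z); last by lia.
  by rewrite wfun_run_end; exact: noncritical_a_an.
rewrite winv_run; try lia.
have -> : (k == k.+1) = false by lia.
have -> : (k == 0) = false by lia.
rewrite (_ : a%:Z + k%:Z + 1 = a%:Z + k.+1%:Z); last by lia.
rewrite winv_run ?eqxx; try lia.
rewrite wfun_run_end wfun_run; try lia.
have -> : (k < n.-1)%N by lia.
rewrite /noncritical /= expo_an -PoszD.
by have [lak|lak] := ltnP (a + k)%N n; [rewrite expo_small | rewrite expo_medium]; lia.
Qed.

(* A palindromic word for the reflection exchanging a and a + n + 1. *)
Definition refl_word : word := run 0 n ++ descent.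

Lemma run_pred k : run k n = run k n.-1.+1.
Proof. by rewrite (prednK (ltnW n_gt1)). Qed.

Lemma refl_wordE : refl_word = run 0 n.-1 ++ inl (ordz (a + n.-1)) :: winv (run 0 n.-1).
Proof. by rewrite /refl_word run_pred run_rcons -catA. Qed.

Lemma refl_word_cons : refl_word = inl (ordz a) :: (run 1 n.-1 ++ descent).
Proof. by rewrite /refl_word run_pred runS addn0. Qed.

Lemma ordz_a : (ordz a : nat) = a. Proof. by rewrite /= modn_small. Qed.

Lemma wfun_run_pred : wfun (run 0 n.-1) (a%:Z - 1) = a%:Z - n%:Z.
Proof.
rewrite (_ : a%:Z - 1 = a%:Z + n.-1%:Z + (- 1) * n%:Z); last by lia.
rewrite (periodicM _ _ (wfun_periodic n_gt1 _)) wfun_run ?ltnn ?eqxx; try lia.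
Qed.

Lemma wfun_run_a : wfun (run 0 n.-1) a%:Z = a%:Z + 1.
Proof.
rewrite -[X in wfun _ X]addr0 -[0]/(0%N%:Z) wfun_run; try lia.
have -> : (0 < n.-1)%N by lia.
by rewrite addr0.
Qed.

Lemma wroots_refl : wroots refl_word =
  (a%:Z - n%:Z, a%:Z + n%:Z + 1) :: wroots (run 1 n.-1 ++ descent).
Proof.
rewrite refl_word_cons /= (modn_small a_ltn); congr ((_, _) :: _); rewrite winv_run_descent.
  rewrite -[X in wfun (winv _) X]addr0 -[0]/(0%N%:Z) winv_run //; try lia.
  by rewrite /= wfun_run_pred.
by rewrite -[1]/(1%N%:Z) winv_run //; try lia; rewrite eqxx wfun_run_end.
Qed.

(** Conjugation of the middle letter by the run, evaluated on images under the run so that no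
    inverse has to be computed. *)
Lemma wfun_refl j : wfun refl_word (wfun (run 0 n.-1) j) =
  wfun (run 0 n.-1) (sfun n (a + n.-1)%N%:Z j).
Proof. by rewrite refl_wordE wfun_cat /= wfunK // sfun_ordz. Qed.

Lemma wfun_refl_near m : (m < n)%N ->
  wfun refl_word (a%:Z + m%:Z) =
    if m == 0 then a%:Z + n%:Z + 1 else if m == 1 then a%:Z - n%:Z else a%:Z + m%:Z.
Proof.
move=> lm; case: eqP => [->|m0].
  have e : wfun (run 0 n.-1) (a%:Z + n.-1%:Z) = a%:Z.
    by rewrite wfun_run ?ltnn ?eqxx; lia.
  rewrite addr0 -{1}e wfun_refl PoszD sfunl //.
  by rewrite (_ : a%:Z + n.-1%:Z + 1 = a%:Z + n%:Z) ?wfun_run_end; lia.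
have e : wfun (run 0 n.-1) (a%:Z + m.-1%:Z) = a%:Z + m%:Z.
  by rewrite wfun_run; try lia; case: ifP; lia.
rewrite -{1}e wfun_refl sfun_near; try lia.
have -> : (m.-1 == n.-1) = false by lia.
have -> : (m.-1 == n.-1.+1) = false by lia.
case: (m =P 1) => [->|m1].
  have -> : (1.-1 == 0) && (n.-1.+1 == n) by lia.
  exact: wfun_run_pred.
have -> : (m.-1 == 0) && (n.-1.+1 == n) = false by lia.
by [].
Qed.

End ReflectionWord.

(** * Conjugation of finite permutations by gamma *)

Section ConjugatePermutation.
Variable n : nat.
Hypothesis n_gt1 : (1 < n)%N.

Definition conjperm (w : 'S_n) (i : int) : int :=
  wext n (wgammainv n) (wext n (wperm w) (wext n (wgamma n) i)).

Lemma wext_wtrans beta (r : 'I_n) m :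
  wext n (wtrans n beta) (ix r m) = ix r (m + beta r).
Proof.
rewrite /wext ix_div // ix_mod // absz_nat /wtrans (nth_map 0%N) ?size_iota //.
by rewrite nth_iota // add0n /ix; ring.
Qed.

Lemma wext_wperm (w : 'S_n) (r : 'I_n) m : wext n (wperm w) (ix r m) = ix (w r) m.
Proof.
rewrite /wext ix_div // ix_mod // absz_nat /wperm.
by rewrite (nth_map r) ?size_enum_ord // nth_ord_enum.
Qed.

Lemma conjperm_ix w (r : 'I_n) m :
  conjperm w (ix r m) = ix (w r) (m - r%:Z + (w r)%:Z).
Proof. by rewrite /conjperm /wgamma wext_wtrans wext_wperm /wgammainv wext_wtrans. Qed.

Lemma ix_shift (r : 'I_n) m k : ix r m + k * n%:Z = ix r (m + k).
Proof. by rewrite /ix; ring. Qed.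

Lemma conjperm_periodic w : periodic n (conjperm w).
Proof.
move=> i; have [r [m ->]] := ixP n_gt1 i.
rewrite -[n%:Z]mul1r ix_shift !conjperm_ix ix_shift.
by congr (ix _ _); ring.
Qed.

(** gamma replaces the quotient m by m - r, which is [expo]; w keeps it and changes the residue, and
    gamma^-1 undoes the correction for the new residue. *)
Lemma expo_conjperm w i : expo n (conjperm w i) = expo n i.
Proof.
have [r [m ->]] := ixP n_gt1 i.
by rewrite conjperm_ix !expo_ix //; ring.
Qed.

Lemma conjperm1 : conjperm 1 =1 id.
Proof.
move=> i; have [r [m ->]] := ixP n_gt1 i.
by rewrite conjperm_ix perm1 subrK.
Qed.

(** Products in ['S_n] are read from left to right, hence the reversed composition. *)
Lemma conjpermM u v : conjperm (u * v)%g =1 conjperm v \o conjperm u.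
Proof.
move=> i; have [r [m ->]] := ixP n_gt1 i.
by rewrite /= !conjperm_ix permM; congr (ix _ _); ring.
Qed.

Lemma wmul_conjperm w :
  wmul n (wmul n (wgammainv n) (wperm w)) (wgamma n) = window n (conjperm w).
Proof.
apply: window_ext => i; rewrite /conjperm.
have [r [m ->]] := ixP n_gt1 i; rewrite /wgamma wext_wtrans.
rewrite wext_window // => j.
have [r' [m' ->]] := ixP n_gt1 j.
rewrite -[n%:Z]mul1r ix_shift !wext_wperm /wgammainv !wext_wtrans ix_shift.
by congr (ix _ _); ring.
Qed.

(** With zero-based residues, [y] as an integer is the one-based index of [x]; so a = y goes to the
    index y + 1 in the next period, which is a + n + 1. *)
Lemma conjperm_tperm (x y : 'I_n) : x.+1 = y :> nat ->
  conjperm (tperm x y) =1 wfun (refl_word n_gt1 y).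
Proof.
move=> xy i; have ly := ltn_ord y; have lx := ltn_ord x.
have [m [k [lm ->]]] := repP n_gt1 y%:Z i.
rewrite (periodicM _ _ (conjperm_periodic _)) (periodicM _ _ (wfun_periodic n_gt1 _)).
congr (_ + _); rewrite wfun_refl_near //; last by rewrite -xy.
case: eqP => [->|m0].
  rewrite (_ : y%:Z + 0%N = ix x 0); last by rewrite /ix; lia.
  rewrite conjperm_ix tpermL (_ : 0 - x%:Z + y%:Z = 1); last by lia.
  by rewrite /ix; lia.
case: eqP => [->|m1].
  rewrite (_ : y%:Z + 1%N = ix y 0); last by rewrite /ix; lia.
  rewrite conjperm_ix tpermR (_ : 0 - y%:Z + x%:Z = - 1); last by lia.
  by rewrite /ix; lia.
have [r [h e]] := ixP n_gt1 (y%:Z + m%:Z).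
rewrite e conjperm_ix tpermD.
- by congr (ix _ _); ring.
- by apply/eqP => er; move: e; rewrite -er /ix; have [h0|h1] := lerP h 0; nia.
- by apply/eqP => er; move: e; rewrite -er /ix; have [h0|h1] := lerP h 0; nia.
Qed.

End ConjugatePermutation.

(** * The leading coefficient at the point *)

Lemma divf_cancel (E : fieldType) (u v x y : E) : u != 0 -> v != 0 -> x != 0 ->
  u / x * (y / (v * u)) = y / (v * x).
Proof. by move=> u0 v0 x0; field; rewrite u0 v0 x0. Qed.

Section LeadingCoefficient.
Variables (K : fieldType) (n : nat) (t : K).
Hypothesis n_gt1 : (1 < n)%N.
Hypothesis t_neq0 : t != 0.
Hypothesis t_nroot : forall m : nat, (0 < m)%N -> t ^+ m != 1.
Local Notation P := {mpoly K[n]}.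
Local Notation F := {fraction P}.
Local Notation Y i := (Yext n t i).
Local Notation f := (fY n t).
Local Notation expo := (expo n).
Local Notation ev_p := (meval (ptrho t : 'I_n -> K)).
Local Notation reg_unit := (@no_zero_no_pole K n t).
Local Notation nuratio := (nuratio n t).

Lemma reg_unit1 : reg_unit 1.
Proof. by exists 1, 1; rewrite meval1 oner_neq0 divr1 tofrac1. Qed.

Lemma reg_unitM g h : reg_unit g -> reg_unit h -> reg_unit (g * h).
Proof.
move=> [a [b [na [nb ->]]]] [c [d [nc [nd ->]]]]; exists (a * c), (b * d).
by rewrite !mevalM !mulf_neq0 // mulf_div !tofracM.
Qed.

Lemma reg_unit_neq0 g : reg_unit g -> g != 0.
Proof.
move=> [a [b [na [nb ->]]]].
by rewrite mulf_neq0 ?invr_eq0 ?tofrac_neq0 // (ev_neq0 (t := t)).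
Qed.

Lemma ev_Ydiff i j : expo i != expo j -> ev_p (Y i - Y j) != 0.
Proof.
move=> nij; rewrite mevalB !ev_Yext // subr_eq0; apply: contra nij => /eqP.
by move=> /(expz_inj n_gt1 t_neq0 t_nroot) ->.
Qed.

Lemma ev_fY_neq0 i j : expo i + 1 != expo j -> ev_p (f i j) != 0.
Proof. by rewrite ev_fY. Qed.

Lemma reg_unit_nuratio i j : expo i != expo j -> expo i + 1 != expo j ->
  reg_unit (nuratio i j).
Proof. by move=> h1 h2; exists (Y i - Y j), (f i j); rewrite ev_Ydiff // ev_fY_neq0. Qed.

Lemma reg_unit_prod (I : eqType) (r : seq I) (G : I -> F) :
  (forall i, i \in r -> reg_unit (G i)) -> reg_unit (\prod_(i <- r) G i).
Proof.
move=> h; rewrite big_seq; elim/big_ind: _ => //; [exact: reg_unit1 | exact: reg_unitM].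
Qed.

(* The zero of the numerator of the first factor cancels the pole of the second. *)
Lemma reg_unit_nuratio2 i j : i != j -> expo i = expo j ->
  reg_unit (nuratio i j * nuratio i (j + n%:Z)).
Proof.
move=> nij eij; have ej : expo (j + n%:Z) = expo j + 1.
  by rewrite -[n%:Z]mul1r expo_shift.
have n1 : expo i + 1 != expo j by rewrite eij; lia.
have n2 : expo i != expo (j + n%:Z) by rewrite eij ej; lia.
have ef : f i (j + n%:Z) = t *: (Y i - Y j).
  rewrite /fY -[n%:Z]mul1r Yext_shift // scalerBr; congr (_ - _).
  by rewrite scalerA /qq -invr_expz expr1z invrK exprS expr1 mulKf.
have ne : Y i != Y j by apply: contra nij => /eqP/(Yext_inj n_gt1 t_neq0 t_nroot) ->.
exists (Y i - Y (j + n%:Z)), (t *: f i j).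
rewrite ev_Ydiff // mevalZ mulf_neq0 ?ev_fY_neq0 //; split=> //; split=> //.
rewrite /nuratio ef -!mul_mpolyC !tofracM.
have d1 : (Y i - Y j)%:F != 0 by rewrite tofrac_neq0 // subr_eq0.
have d2 : (t%:MP_[n])%:F != 0 by rewrite tofrac_neq0 // mpolyC_eq0.
have d3 : (f i j)%:F != 0 by rewrite tofrac_neq0 // (ev_neq0 (t := t)) // ev_fY_neq0.
move: (Y i - Y j)%:F (t%:MP%:F) (f i j)%:F (Y i - Y (j + n%:Z))%:F d1 d2 d3 => u v x y d1 d2 d3.
exact (@divf_cancel F u v x y d1 d2 d3).
Qed.

Lemma pairslope_conjperm (w : 'S_n) (x y : 'I_n) (b : bool) : b = (w y < w x)%N ->
  pairslope (conjperm w) x y = (w y)%:Z - (w x)%:Z - (y%:Z - x%:Z) - b%:Z.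
Proof.
move=> ->; rewrite /pairslope !ix0 !conjperm_ix // /ix.
have lx := ltn_ord (w x); have ly := ltn_ord (w y).
have := @divz_diff n n_gt1 1 (w x) (w y) (0 - x%:Z + (w x)%:Z) (0 - y%:Z + (w y)%:Z) lx ly.
by rewrite ![1 + _]addrC => ->; lia.
Qed.

(** For x < y the numerator of the ratio at (x, y + j n) vanishes for j = y - x, the denominator for
    j = y - x + 1. Both j occur if w inverts the pair and neither otherwise; at (y - j n, x) with j
    > 0 nothing vanishes. *)
Lemma reg_unit_invterm (w : 'S_n) (x y : 'I_n) : (x < y)%N ->
  reg_unit (invterm n *%R nuratio (x%:Z + 1) (y%:Z + 1) (pairslope (conjperm w) x y)).
Proof.
move=> lxy; rewrite (pairslope_conjperm (b := (w y < w x)%N)) //.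
have ex k : expo (x%:Z + 1 + k * n%:Z) = k - x%:Z.
  by rewrite expo_shift // expo_small //; lia.
have ey k : expo (y%:Z + 1 + k * n%:Z) = k - y%:Z.
  by rewrite expo_shift // expo_small //; lia.
have ex0 : expo (x%:Z + 1) = - x%:Z by rewrite expo_small.
have far (j : nat) : (j != y - x)%N -> (j != (y - x).+1)%N ->
    reg_unit (nuratio (x%:Z + 1) (y%:Z + 1 + j%:Z * n%:Z)).
  by move=> j1 j2; apply: reg_unit_nuratio; rewrite ex0 ey; lia.
have nw : w x != w y :> nat by rewrite (inj_eq val_inj) (inj_eq perm_inj) neq_ltn lxy.
case: ltnP => lw /=.
  pose d := (y - x)%N; pose e := (w x - w y)%N.
  have e0 : (0 < e)%N by rewrite subn_gt0.
  have -> : (w y)%:Z - (w x)%:Z - (y%:Z - x%:Z) - 1%N%:Z = Negz (d + e).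
    by rewrite NegzE /d /e; lia.
  (* The middle block consists of the indices d and d + 1. *)
  rewrite /= (@big_cat_nat _ _ _ d) //=; last by lia.
  rewrite (@big_cat_nat _ _ _ d.+2 d) //=; try lia.
  rewrite (big_nat_recl d.+1) // big_nat1.
  apply: reg_unitM.
    by apply: reg_unit_prod => j; rewrite mem_index_iota => hj; apply: far; lia.
  apply: reg_unitM; last first.
    by apply: reg_unit_prod => j; rewrite mem_index_iota => hj; apply: far; lia.
  have -> : y%:Z + 1 + d.+1%:Z * n%:Z = y%:Z + 1 + d%:Z * n%:Z + n%:Z.
    by rewrite -addn1 PoszD; ring.
  apply: reg_unit_nuratio2; last by rewrite ex0 ey /d; lia.
  by rewrite /d; nia.
rewrite subr0; case s: (_ - _ - _) => [m|m] /=.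
  apply: reg_unit_prod => j; rewrite mem_index_iota => hj.
  by apply: reg_unit_nuratio; rewrite -mulNr ex0 ey; lia.
by apply: reg_unit_prod => j; rewrite mem_index_iota => hj; apply: far; lia.
Qed.

Lemma reg_unit_leadcoef (w : 'S_n) : reg_unit (invprod n *%R nuratio (conjperm w)).
Proof.
rewrite /invprod; elim/big_ind: _ => [||[x y]]; [exact: reg_unit1 | exact: reg_unitM |].
exact: reg_unit_invterm.
Qed.

End LeadingCoefficient.

(** * Regularity of all coefficients at the point *)

Section Regularity.
Variables (K : fieldType) (n : nat) (t : K).
Hypothesis n_gt1 : (1 < n)%N.
Hypothesis t_neq0 : t != 0.
Hypothesis t_nroot : forall m : nat, (0 < m)%N -> t ^+ m != 1.
Local Notation P := {mpoly K[n]}.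
Local Notation F := {fraction P}.
Local Notation Y i := (Yext n t i).
Local Notation f := (fY n t).
Local Notation word := (seq (letter n)).
Local Notation expo := (expo n).
Local Notation act := (@act K n t).
Local Notation ev_p := (meval (ptrho t : 'I_n -> K)).
Local Notation c := (t - t^-1).

Variables (A : algType K) (T : 'I_n -> A) (pi piinv : A).
Variables (ev : {rmorphism P -> A}) (iota : F -> A) (Tw : seq int -> A).
Hypothesis hrel : daha_relations t T pi piinv ev.
Hypothesis hiota : iota_spec t ev iota.
Hypothesis hTw : Tw_spec T pi piinv Tw.
Hypothesis huniq : unique_normal_ordering t iota Tw.

Local Notation nuw := (nuword t T pi piinv ev iota).
Local Notation Tword := (Tword T pi piinv).
Local Notation phiword := (phiword t T pi piinv ev).
Local Notation Tspan := (Tspan T pi piinv iota).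
Local Notation inKreg := (@inKreg K n t).
Local Notation regspan := (Tspan (@reduced n) inKreg).
Local Notation cR := (coeffs_inKreg n_gt1 t_neq0).

Lemma regspan_below h : regspan h -> exists k, Tspan (@below n k) inKreg h.
Proof.
elim=> [|wd g h' rw rg _ [k IH]]; first by exists 0%N; exact: span0.
exists (maxn (scount wd).+1 k); apply: spanS => //; first by split; rewrite // leq_maxl.
by apply: span_sub IH => w [? lw]; split=> //; exact: leq_trans lw (leq_maxr _ _).
Qed.

Lemma below_regspan k h : Tspan (@below n k) inKreg h -> regspan h.
Proof. by apply: span_sub => w []. Qed.

Lemma regspan_Tletter l h : regspan h -> regspan (Tletter T pi piinv l * h).
Proof.
case/regspan_below => k sh; case: l => [i|b].
  exact: below_regspan (span_T n_gt1 t_neq0 hrel hiota hTw cR i sh).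
exact: below_regspan (span_inr n_gt1 b sh).
Qed.

Lemma regspan_ev p h : regspan h -> regspan (ev p * h).
Proof.
case/regspan_below => k sh.
exact: below_regspan (span_evl n_gt1 t_neq0 hrel hiota hTw cR p sh).
Qed.

Lemma regspan_mulr h g : regspan h -> inKreg g -> regspan (h * iota g).
Proof. exact: (span_mulr n_gt1 t_neq0 hrel hiota cR). Qed.

Lemma regspan1 : regspan 1.
Proof.
rewrite -[X in regspan X](mulr1 1) -{2}(rmorph1 ev) -(iota_poly n_gt1 t_neq0 hrel hiota).
have -> : 1 = Tword [::] :> A by rewrite /Tword big_nil.
by apply: span_term; [exact: reduced_nil | exact: inKreg_poly].
Qed.

(** phi_l has polynomial coefficients, so left multiplication by it introduces no denominator. *)
Lemma regspan_phi l h : regspan h -> regspan (philetter t T pi piinv ev l * h).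
Proof.
case: l => [i|[]] sh /=; [|exact: (regspan_Tletter (inr true))|exact: (regspan_Tletter (inr false))].
rewrite (phiE n_gt1 t_neq0 hrel) mulrDl -mulrA; apply: spanD; last exact: regspan_ev.
exact/(regspan_Tletter (inl i))/regspan_ev.
Qed.

Lemma regspan_phiword wd h : regspan h -> regspan (phiword wd * h).
Proof.
elim: wd => [|l wd IH] sh; first by rewrite /phiword big_nil mul1r.
by rewrite phiword_cons -mulrA; exact/regspan_phi/IH.
Qed.

Lemma regspan_Tword wd h : regspan h -> regspan (Tword wd * h).
Proof.
elim: wd => [|l wd IH] sh; first by rewrite /Tword big_nil mul1r.
by rewrite Tword_cons -mulrA; exact/regspan_Tletter/IH.
Qed.

(** Two fractions represent [g]: a / d with d admissible, to which intertwining applies, and a' / b'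
    with b' nonzero at the point, which shows regularity. Both are acted on, and cross
    multiplication compares the results. *)
Lemma inKreg_act s s' g : periodic n s -> cancel s s' -> (forall i, expo (s i) = expo i) ->
  inKreg g ->
  exists2 g', inKreg g' & forall h, intertwines t ev h s -> iota g * h = h * iota g'.
Proof.
move=> ps sK es [/(inKP n_gt1 t_neq0)[a [d [hd eg]]] [a' [b' [nb' eg']]]].
have hd' := adm_act n_gt1 t_neq0 ps sK hd.
exists ((act s a)%:F / (act s d)%:F); last first.
  by move=> h hh; rewrite eg; exact: (iota_int n_gt1 t_neq0 hrel hiota a hh ps sK hd).
split; first exact: inK_frac.
have nb : ev_p (act s b') != 0 by rewrite (ev_act n_gt1 t_neq0 _ es).
exists (act s a'), (act s b'); split=> //.
apply/tofrac_divP; [exact: adm_neq0 hd' | exact: ev_neq0 nb |].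
rewrite -!actM; congr (act s _).
by apply/tofrac_divP; [exact: adm_neq0 hd | exact: ev_neq0 nb' | rewrite -eg -eg'].
Qed.

(** Any word is allowed, reduced or not, since nu depends on the group element only. *)
Definition regperm (w : 'S_n) : Prop :=
  exists2 wd : word, wfun wd =1 conjperm w & regspan (nuw wd).

Lemma regperm1 : regperm 1%g.
Proof.
exists [::]; first by move=> i; rewrite conjperm1.
by rewrite /nuword big_nil; exact: regspan1.
Qed.

(* The point t^(-2 rho) is fixed by gamma^-1 S_n gamma, so regular coefficients can be *)
(* moved to the right of nu_v, where H nu_v is already regular.                        *)
Lemma regpermM u v : regperm u -> regperm v -> regperm (u * v)%g.
Proof.
move=> [wu eu ru] [wv ev' rv].
exists (wv ++ wu); first by move=> i; rewrite wfun_cat /= eu ev' conjpermM.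
rewrite nuw_cat; elim: rv => [|wd g h rw rg _ IH]; first by rewrite mul0r; exact: span0.
rewrite mulrDl -mulrA; apply: spanD => //.
have es i : expo (wfun (winv wu) i) = expo i.
  by rewrite -[in RHS](wfunVK n_gt1 wu i) eu expo_conjperm.
have [g' rg' eg'] := inKreg_act (wfun_periodic n_gt1 _) (wfunK n_gt1 (winv wu)) es rg.
rewrite eg'; last exact: nuword_int.
by apply: regspan_Tword; exact: regspan_mulr.
Qed.

Lemma ev_prod_noncritical (r : seq (int * int)) : all (noncritical n) r ->
  ev_p (\prod_(p <- r) f p.1 p.2) != 0.
Proof.
elim: r => [|p r IH]; first by rewrite big_nil meval1 oner_neq0.
move=> /= /andP[np /IH nr]; rewrite big_cons mevalM mulf_neq0 //.
exact: ev_fY_neq0.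
Qed.

Lemma adm_prod_wroots (wd : word) : adm t (\prod_(p <- wroots wd) f p.1 p.2).
Proof.
elim: wd => [|[i|b] wd IH] //=; first by rewrite big_nil; exact: adm1.
by rewrite big_cons; apply: admM => //; exact: adm_root.
Qed.

(* Writing phi_i = T_i D + E splits phi_U into a term with right factor D and a polynomial *)
(* phi_x phi_(x^-1) E; both are divisible by the only factor f_(a+1,a) of the denominator  *)
(* of nu_U that vanishes at the point.                                                     *)
Lemma regspan_refl (a : nat) : (0 < a < n)%N -> regspan (nuw (refl_word n_gt1 a)).
Proof.
move=> /andP[a0 an]; set U := refl_word n_gt1 a.
set d := f (a%:Z + 1) a%:Z.
have hd : adm t d by exact: fY_adm_pred.
set R := \prod_(p <- wroots (run n_gt1 a 1 n.-1 ++ descent n_gt1 a)) f p.1 p.2.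
(* Since q = t^-2, f at (a - n, a + n + 1) is t^-1 Y_a - t Y_(a+1) = -d. *)
have eR : \prod_(p <- wroots U) f p.1 p.2 = - d * R.
  rewrite wroots_refl // big_cons /=; congr (_ * _).
  rewrite (_ : a%:Z + n%:Z + 1 = a%:Z + 1 + 1 * n%:Z); last by ring.
  rewrite (_ : a%:Z - n%:Z = a%:Z + (- 1) * n%:Z); last by ring.
  rewrite /d /fY !Yext_shift // opprB opprK expr1z -invr_expz expr1z invrK.
  move: (Y a) (Y (a%:Z + 1)) => y y'; rewrite !scalerA.
  by congr (_ *: _ - _ *: _); [rewrite /qq; field | field].
have hU := nuw_phiw n_gt1 t_neq0 hrel hiota U.
(* Cancelling the unit [ev d] then leaves only the denominator [R], which is nonzero at the
   point. *)
suff [h sh eh] : exists2 h, regspan h & phiword U = h * ev d.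
  have nR : ev_p R != 0 by apply: ev_prod_noncritical; apply: wroots_ascending => //; lia.
  have hR : adm t R by exact: adm_prod_wroots.
  have -> : nuw U = h * iota ((-1)%:F / R%:F).
    apply: (unitA_mulIr (ev_unit hrel hiota (admM hd hR))).
    rewrite rmorphM evCm [in RHS]mulrA -(mulrA h).
    rewrite (iotaE n_gt1 t_neq0 hrel hiota (inK_frac n_gt1 t_neq0 (-1) hR) hR (tofracV_mul n_gt1 t_neq0 _ hR)).
    rewrite -rmorphM -[R * d]opprK -mulrN mulrC -eR rmorphN mulrN hU eh.
    by rewrite rmorphN rmorph1 mulrN1 mulNr.
  apply: regspan_mulr => //; split; first exact: inK_frac.
  exact: regular_frac.
rewrite /U refl_wordE phiword_cat phiword_cons /=.
set X := run n_gt1 a 0 n.-1; set o := ordz n_gt1 (a + n.-1).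
(* The middle letter s_(a+n-1) is s_(a-1). *)
have eo : (o : nat) = a.-1 by rewrite /= (_ : a + n.-1 = a.-1 + n)%N ?modnDr ?modn_small; lia.
rewrite (phiE n_gt1 t_neq0 hrel) mulrDl -mulrA !(phiword_int n_gt1 t_neq0 hrel) winvK.
have pX := wfun_periodic n_gt1 X.
rewrite actB (actZ _ _ c) !actY // eo.
have -> : a.-1%:Z = a%:Z - 1 by lia.
rewrite subrK wfun_run_pred // wfun_run_a //.
(* The first letter of [X] is s_a, which yields the factor f_(a+1,a) = d. *)
have [p ep] : exists p, phiword X * phiword (winv X) = ev (p * d).
  rewrite /X -(prednK (_ : 0 < n.-1)%N); last by lia.
  rewrite runS addn0.
  have [p ep] := phiw_winv_inl n_gt1 t_neq0 hrel (ordz n_gt1 a) (run n_gt1 a 1 n.-2).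
  by exists p; rewrite ep ordz_a.
(* The coefficient Y_(a-1) - Y_a of the middle T arrives at the right end as Y_(a-n) - Y_(a+1), a
   multiple of d because q = t^-2. *)
have eD : Y (a%:Z - n%:Z) - Y (a%:Z + 1) = (- t^-1)%:MP * d.
  rewrite (_ : a%:Z - n%:Z = a%:Z + (- 1) * n%:Z); last by ring.
  rewrite Yext_shift // opprK expr1z mul_mpolyC /d /fY.
  move: (Y a) (Y (a%:Z + 1)) => y y'; rewrite scalerBr !scalerA.
  by rewrite mulNr mulVf // scaleN1r mulNr scaleNr opprK addrC /qq exprS expr1 invfM.
exists (phiword X * (T o * (phiword (winv X) * ev (- t^-1)%:MP)) +
        ev (p * (c *: Y (a%:Z + 1)))).
  apply: spanD; last by rewrite -[ev _]mulr1; apply: regspan_ev; exact: regspan1.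
  apply/regspan_phiword/(regspan_Tletter (inl o))/regspan_phiword.
  by rewrite -[ev _]mulr1; apply: regspan_ev; exact: regspan1.
rewrite mulrDr mulrDl; congr (_ + _).
  by rewrite eD rmorphM !mulrA.
by rewrite mulrA ep -!rmorphM; congr (ev _); ring.
Qed.

Lemma regperm_adjacent (x y : 'I_n) : x.+1 = y :> nat -> regperm (tperm x y).
Proof.
move=> xy; exists (refl_word n_gt1 y); first by move=> i; rewrite (conjperm_tperm n_gt1 xy).
by apply: regspan_refl; rewrite -xy ltn0Sn xy ltn_ord.
Qed.

(** Induction on y - x: (x y) is the conjugate of (x z) by the adjacent transposition (z y), where z
    = y - 1. *)
Lemma regperm_tperm (x y : 'I_n) : regperm (tperm x y).
Proof.
wlog lxy : x y / (x <= y)%N.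
  by move=> H; case/orP: (leq_total x y) => /H //; rewrite tpermC.
elim: {y}(y - x)%N {-2}y (erefl (y - x)%N) lxy => [|k IH] y ek lxy.
  rewrite (_ : y = x) ?tperm1; first exact: regperm1.
  by apply: val_inj => /=; lia.
have lz : (y.-1 < n)%N by have := ltn_ord y; lia.
pose z := Ordinal lz.
have zy : z.+1 = y :> nat by rewrite /=; lia.
have [xz|nxz] := eqVneq x z; first by rewrite xz; exact: regperm_adjacent.
have nxy : x != y by apply/eqP => e; move: ek; rewrite e; lia.
have nzy : z != y by apply/eqP => /(congr1 val) /=; lia.
have -> : tperm x y = (tperm z y * (tperm x z * tperm z y))%g.
  rewrite -{1}[tperm z y]tpermV -conjgE tpermJ tpermL.
  by rewrite tpermD // eq_sym.
have adj := regperm_adjacent zy.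
by do 2?apply: regpermM => //; apply: IH => /=; lia.
Qed.

Lemma regperm_all (w : 'S_n) : regperm w.
Proof.
have [ts -> _] := prod_tpermP w.
by elim/big_ind: _ => [||p _]; [exact: regperm1 | exact: regpermM | exact: regperm_tperm].
Qed.

End Regularity.

(** * Leading term and regularity combined by uniqueness of the normal ordering *)

Theorem theorem6p11
  (K : fieldType) (t : K) (n : nat)
  (ht0 : t != 0) (ht : forall m : nat, (0 < m)%N -> t ^+ m != 1)
  (hn : (2 <= n)%N)
  (A : algType K) (T : 'I_n -> A) (pi piinv : A)
  (ev : {rmorphism {mpoly K[n]} -> A})
  (iota : {fraction {mpoly K[n]}} -> A)
  (Tw : seq int -> A)
  (hrel : daha_relations t T pi piinv ev)
  (hiota : iota_spec t ev iota)
  (hTw : Tw_spec T pi piinv Tw)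
  (huniq : unique_normal_ordering t iota Tw)
  (w : 'S_n) :
  let x0 := wmul n (wmul n (wgammainv n) (wperm w)) (wgamma n) in
  forall wd : seq (letter n), wval wd = x0 -> reduced wd ->
  forall (s : seq (seq int)) (g : seq int -> {fraction {mpoly K[n]}}),
    normal_ordering t iota Tw (nuword t T pi piinv ev iota wd) s g ->
    [/\ nocoef s g x0 != 0,
        (forall x, x != x0 -> nocoef s g x != 0 -> shorter n x x0),
        no_zero_no_pole t (nocoef s g x0) &
        (forall x, no_pole t (nocoef s g x))].
Proof.
move=> x0 wd ewd rd s g no.
have ewf : wfun wd =1 conjperm w.
  move=> i; rewrite -(wext_wval hn) ewd /x0 (wmul_conjperm hn).
  by rewrite wext_window //; exact: conjperm_periodic.
have [h [sh eh]] := nu_lead hn ht0 hrel hiota hTw rd.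
have no' := no; rewrite eh in no'.
have hP (v : seq (letter n)) : below (scount wd) v -> reduced v /\ wval v != wval wd.
  move=> [rv lv]; split=> //; apply: contraTneq lv => e.
  by rewrite -leqNgt (reduced_scount hn rd rv) //; apply/(wvalP hn).
have [e1 e2] := normal_lead hn ht0 hrel hiota hTw huniq rd
  (inK_leadcoef hn ht0 wd) hP sh no'.
rewrite ewd in e1 e2.
have unit0 : no_zero_no_pole t (nocoef s g x0).
  rewrite e1 leadcoef_invprod // (_ : invprod _ _ _ _ =
    invprod n *%R (nuratio n t) (conjperm w)); last exact: invprod_ext.
  exact: reg_unit_leadcoef.
split=> //; first exact: reg_unit_neq0 unit0.
  move=> x nx /(e2 x nx)[v [rv lv] ev']; exists v; split=> // v' ev''.
  by apply: (leq_trans lv); apply: rd; rewrite ev''.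
(* [wr] may differ from [wd], but its intertwiner is the same element, and its regular normal
   ordering has the coefficients of the given one by uniqueness. *)
have [wr er sr] := regperm_all hn ht0 ht hrel hiota hTw w.
have en : nuword t T pi piinv ev iota wd = nuword t T pi piinv ev iota wr.
  by apply: (nuw_ext hn ht0 ht hrel hiota hTw huniq) => i; rewrite ewf er.
have [s3 [g3 [no3 hg3]]] := span_normal hn ht0 hrel hiota hTw
  (coeffs_inKreg hn ht0) (fun _ r => r) sr.
rewrite -en in no3; move=> x; rewrite (huniq _ _ _ _ _ no no3) /nocoef.
case: ifP => [/hg3[_ []]//|_].
(* Outside the support the coefficient is 0 = 0 / 1. *)
by exists 0, 1; rewrite meval1 oner_neq0 tofrac0 mul0r.
Qed.
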